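(* The set of decomposable torsion-free abelian groups of infinite rank, i.e. the set of all group operations on $\omega$, viewed as points of the Polish space $\omega^{\omega\times\omega}$, that make $\omega$ into a decomposable torsion-free abelian group of infinite rank, is $\boldsymbol{\Sigma^1_1}$-complete.
   Context: Countably infinite groups (not necessarily computable) are presented with domain $\omega$ and identified with their group operation, an element of $\omega^{\omega\times\omega}$ with the product topology (each factor $\omega$ discrete), a space homeomorphic to Baire space $\omega^\omega$. A basis of a torsion-free abelian group is a maximal linearly independent subset, and the rank of the group is the cardinality of any basis. An abelian group is decomposable if it can be written as the direct sum of two (or more) nontrivial subgroups; otherwise it is indecomposable. A subset of a Polish space is $\boldsymbol{\Sigma^1_1}$ (analytic) if it is the image of a Polish space under a continuous map (or empty). A subset $A$ of a Polish space $X$ is $\boldsymbol{\Sigma^1_1}$-complete if it is $\boldsymbol{\Sigma^1_1}$ and for every $\boldsymbol{\Sigma^1_1}$ set $B\subseteq\omega^\omega$ there is a continuous function $f:\omega^\omega\to X$ such that $x\in B$ if and only if $f(x)\in A$. *)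

(* Defs.v *)
From HB Require Import structures.
From mathcomp Require Import all_boot all_order all_algebra.
From mathcomp Require Import all_classical all_reals all_analysis.
Set Implicit Arguments.
Unset Strict Implicit.
Unset Printing Implicit Defensive.
Import Order.TTheory GRing.Theory Num.Theory.
Local Open Scope classical_set_scope.
Local Open Scope ring_scope.

Definition separable_space (T : topologicalType) : Prop :=
  exists2 D : set T, countable D & dense D.

(* The axiom of the library's [completeType], without its base point. *)
Definition complete_space (T : uniformType) : Prop :=
  forall F : set_system T, ProperFilter F -> cauchy F -> exists l : T, F --> l.

Definition homeomorphic (S T : topologicalType) : Prop :=
  exists (f : S -> T) (g : T -> S),
    [/\ cancel f g, cancel g f, continuous f & continuous g].

Definition polish (R : realType) (T : topologicalType) : Prop :=
  separable_space T /\
  exists2 M : metricType R, complete_space M & homeomorphic M T.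

Definition sigma11 (R : realType) (X : topologicalType) (A : set X) : Prop :=
  A = set0 \/
  exists (P : topologicalType) (f : P -> X),
    [/\ polish R P, continuous f & A = range f].

(* The library's topology on [nat] is discrete and [{ptws _ -> _}] is the
   product topology. *)
Notation baire_space := {ptws nat -> nat}.
Notation op_space := {ptws nat * nat -> nat}.

Definition sigma11_complete (R : realType) (X : topologicalType) (A : set X)
    : Prop :=
  [/\ polish R X,
      sigma11 R A &
      forall B : set baire_space, sigma11 R B ->
        exists2 f : baire_space -> X,
          continuous f & forall x : baire_space, B x <-> A (f x)].

Definition abelian_group_op (m : op_space) : Prop :=
  let op x y := m (x, y) in
  exists (e : nat) (inv : nat -> nat),
    [/\ associative op, commutative op, left_id e op & left_inverse e inv op].

(* [nat] under an alias, since [nat] itself already carries the usual addition;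
   the neutral element and the inverses are the ones determined by [m]. *)
Definition omega_group (m : op_space) (mG : abelian_group_op m) : Type := nat.

Section OmegaGroup.
Context (m : op_space) (mG : abelian_group_op m).

HB.instance Definition _ := Choice.copy (omega_group mG) nat.

Let add (x y : omega_group mG) : omega_group mG := m (x, y).
Let zero : omega_group mG := sval (cid mG).
Let opp : omega_group mG -> omega_group mG := sval (cid (svalP (cid mG))).

Let addA : associative add.
Proof. by case: (svalP (cid (svalP (cid mG)))). Qed.
Let addC : commutative add.
Proof. by case: (svalP (cid (svalP (cid mG)))). Qed.
Let add0 : left_id zero add.
Proof. by case: (svalP (cid (svalP (cid mG)))). Qed.
Let addN : left_inverse zero opp add.
Proof. by case: (svalP (cid (svalP (cid mG)))). Qed.

HB.instance Definition _ :=
  GRing.isZmodule.Build (omega_group mG) addA addC add0 addN.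
End OmegaGroup.

Definition torsion_free (G : zmodType) : Prop :=
  forall (x : G) (n : nat), (0 < n)%N -> x *+ n = 0 -> x = 0.

Definition lin_independent (G : zmodType) (S : set G) : Prop :=
  forall (s : seq G) (c : G -> int), uniq s -> [set` s] `<=` S ->
    \sum_(x <- s) x *~ c x = 0 -> forall x, x \in s -> c x = 0.

Definition group_basis (G : zmodType) (B : set G) : Prop :=
  lin_independent B /\
  forall S : set G, lin_independent S -> B `<=` S -> S = B.

(* All bases have the same cardinality, so any one of them witnesses the
   rank. *)
Definition infinite_rank (G : zmodType) : Prop :=
  exists2 B : set G, group_basis B & infinite_set B.

Definition subgroup (G : zmodType) (H : set G) : Prop :=
  H 0 /\ forall x y, H x -> H y -> H (x - y).

Definition nontrivial (G : zmodType) (H : set G) : Prop :=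
  exists2 x, H x & x <> 0.

Definition direct_sum (G : zmodType) (H K : set G) : Prop :=
  H `&` K = [set 0] /\
  forall x : G, exists h k, [/\ H h, K k & x = h + k].

(* A decomposition into more than two nontrivial summands gives one into two by
   grouping summands. *)
Definition decomposable (G : zmodType) : Prop :=
  exists H K : set G,
    [/\ subgroup H, subgroup K, nontrivial H, nontrivial K & direct_sum H K].

Definition decomposable_tf_groups_of_infinite_rank : set op_space :=
  [set m | exists mG : abelian_group_op m,
    let G : zmodType := omega_group mG in
    [/\ torsion_free G, infinite_rank G & decomposable G]].

(* Main.v *)
From HB Require Import structures.
Require Import Defs.
From mathcomp Require Import all_boot all_order all_algebra.
From mathcomp Require Import all_classical all_reals all_analysis.
From mathcomp Require Import zify.

(** The set is analytic because membership in it can be witnessed by natural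
    numbers: an operation [m] belongs to it exactly when there are a neutral
    element, an inverse function, a nontrivial additive idempotent (the
    projection onto one summand) and a linearly independent sequence, and each
    of the resulting requirements is a family of conditions on finitely many
    values of [m] and of the witnesses.  So the set is the projection of a
    closed set, and a nonempty closed set of functions is a continuous image of
    the space of all of them by a retraction ([sigma11_projection],
    [tf_decompositionP], [sigma11_decomposable]).

    For hardness, an analytic set [B] is represented by trees [T x] on the
    natural numbers that depend continuously on [x], such that [x] is in [B]
    exactly when [T x] has an infinite branch ([sigma11_branch]).  To a tree [T]
    is attached a subgroup [tree_group T] of the rational vector space with
    basis vectors [k_n], one for each level [n], [h_s], one for each finite
    sequence [s], and [g].  It is generated by fractions [v / p^N], for finitely
    or infinitely many vectors [v] sharing each prime [p]:
    - each [h_s] has a prime, and so have [g] and each [h_s + g];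
    - for each [n], one prime serves [k_n] and all [h_s] with [s] of length [n];
    - for each [n], one prime serves [k_n + k_(n+1) + g] and all links
      [k_n + k_(n+1) + h_s + h_t], where [t] is a node of [T] of length [n + 1]
      and [s] is its parent.
    An endomorphism preserves divisibility by all powers of [p], and integral
    functionals vanishing on the vectors attached to [p] detect this
    divisibility ([pairing_divisible0]); so an endomorphism maps the vectors
    attached to [p] into their rational span.

    A branch [t_0, t_1, ...] gives the idempotent endomorphism that kills every
    [h_s] and [g] and sends [k_n] to [k_n + h_(t_n)]; links are sent to links
    ([branch_splitting]).  Conversely, let [P] be an idempotent endomorphism.  By
    the first item it is a scalar, 0 or 1, on all [h_s] and [g]; replace [P] by
    [1 - P] if it is 1.  Then [P k_n] is either 0 for all [n], and [P = 0], or is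
    [k_n + v_n] for all [n], with [v_n] a finite combination of the [h_s] of
    level [n].  In the second case the image of [k_n + k_(n+1) + g] has to be a
    combination of links, and this says that [v_(n+1)] is supported on nodes of
    [T], that taking parents turns [v_(n+1)] into [v_n], and that [v_0] is
    [h] at the root.  Every [s] in the support of [v_n] hence has a child in the
    support of [v_(n+1)], and following children produces a branch
    ([splitting_branch]).

    Finally [tree_group (T x)] is countable and infinite, and its elements can be
    enumerated without repetition so that each value of the transported
    operation on the natural numbers depends on finitely many values of [x]
    ([tree_reduction]). *)

Set Implicit Arguments.
Unset Strict Implicit.
Unset Printing Implicit Defensive.
Import Order.TTheory GRing.Theory Num.Theory.
Local Open Scope classical_set_scope.
Local Open Scope ring_scope.

(** * Finitely determined functions *)

Section FiniteDetermination.
Context {I : countType}.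
Implicit Types x y z : I -> nat.

Definition agree (n : nat) x y := forall i, (pickle i < n)%N -> x i = y i.

Lemma agree_sym n x y : agree n x y -> agree n y x.
Proof. by move=> xy i /xy. Qed.

Lemma agree_trans n x y z : agree n x y -> agree n y z -> agree n x z.
Proof. by move=> xy yz i lt_i; rewrite xy ?yz. Qed.

Lemma agree_leq m n x y : (m <= n)%N -> agree n x y -> agree m x y.
Proof. by move=> le_mn xy i lt_i; apply: xy; exact: leq_trans le_mn. Qed.

Lemma agree_eq x y : (forall n, agree n x y) -> x = y.
Proof. by move=> xy; apply/funext => i; exact: (xy (pickle i).+1). Qed.

(** Local constancy with an explicit finite set of coordinates: it composes
    freely, including at codomains without a topology. *)
Definition fin_det (S : Type) (f : (I -> nat) -> S) :=
  forall x, exists n, forall y, agree n x y -> f y = f x.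

Lemma fin_det_cst S (a : S) : fin_det (fun=> a).
Proof. by move=> x; exists 0%N. Qed.

Lemma fin_det_eval i : fin_det (fun x => x i).
Proof. by move=> x; exists (pickle i).+1 => y /(_ i (ltnSn _)). Qed.

(** The coordinates read by [g (t x)] are chosen once those read by [t] have
    fixed the value of [t x]; all other closure properties follow. *)
Lemma fin_det_bind A S (t : (I -> nat) -> A) (g : A -> (I -> nat) -> S) :
  fin_det t -> (forall a, fin_det (g a)) -> fin_det (fun x => g (t x) x).
Proof.
move=> tfd gfd x; have [m tm] := tfd x; have [n gn] := gfd (t x) x.
exists (maxn m n) => y xy; rewrite tm; last exact: agree_leq (leq_maxl _ _) xy.
by apply: gn; exact: agree_leq (leq_maxr _ _) xy.
Qed.

Lemma fin_det_map A S (h : A -> S) (t : (I -> nat) -> A) :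
  fin_det t -> fin_det (fun x => h (t x)).
Proof.
move=> tfd; apply: (fin_det_bind (g := fun a _ => h a)) => // a.
exact: fin_det_cst.
Qed.

Lemma fin_det_map2 A B S (h : A -> B -> S)
    (t : (I -> nat) -> A) (u : (I -> nat) -> B) :
  fin_det t -> fin_det u -> fin_det (fun x => h (t x) (u x)).
Proof.
move=> tfd ufd; apply: (fin_det_bind (g := fun a x => h a (u x))) => // a.
exact: fin_det_map.
Qed.

Lemma fin_det_seq S (g : nat -> (I -> nat) -> S) n :
  (forall i, fin_det (g i)) -> fin_det (fun x => mkseq (g^~ x) n).
Proof.
move=> gfd; elim: n => [|n IHn]; first exact: fin_det_cst.
rewrite (_ : (fun x => _) = fun x => rcons (mkseq (g^~ x) n) (g n x)).
  exact: fin_det_map2.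
by apply/funext => x; rewrite -mkseqS.
Qed.

End FiniteDetermination.

(** * The space of natural-valued functions on a countable set is Polish *)

Section PointwiseTopology.
Context {I : countType}.
Local Notation X := {ptws I -> nat}.

Lemma nbhs_agree (x : X) (A : set X) :
  nbhs x A <-> exists n, forall y : X, agree n x y -> A y.
Proof.
split=> [|[n nA]].
  pose F : set_system X := [set A | exists n, forall y : X, agree n x y -> A y].
  have FF : Filter F.
    split=> [|B C [m mB] [n nC]|B C BC [n nB]]; first by exists 0%N.
      exists (maxn m n) => y xy; split; [apply: mB | apply: nC];
        by apply: agree_leq xy; rewrite ?leq_maxl ?leq_maxr.
    by exists n => y /nB /BC.
  suff : F --> x by exact.
  apply/cvg_sup => i U [V] [[W] oW <-] Wx WU.
  exists (pickle i).+1 => y xy; apply: WU => /=.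
  by rewrite /= -(xy i (ltnSn _)).
(* Coordinate projections are continuous and points of [nat] are open. *)
have coord_near i : nbhs x ([set y : X | x i = y i] : set X).
  apply: (@proj_continuous I (fun=> nat) i x [set k | x i = k]).
  by apply/principal_filterP.
have near_agree : nbhs x ([set y : X | agree n x y] : set X).
  elim: n {nA} => [|n IHn]; first by apply: filterE => y i.
  have [[i ni]|none] := pselect (exists i : I, pickle i = n).
    apply: filterS2 IHn (coord_near i) => y xy xyi j; rewrite ltnS leq_eqVlt.
    by rewrite -ni => /orP[/eqP/(pcan_inj pickleK) ->|] //; rewrite ni => /xy.
  apply: filterS IHn => y xy j; rewrite ltnS leq_eqVlt => /orP[/eqP jn|/xy //].
  by case: none; exists j.
by apply: filterS near_agree => y; exact: nA.
Qed.

End PointwiseTopology.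

Lemma fin_det_agree (I J : countType) (f : (I -> nat) -> J -> nat) x n :
  (forall j, fin_det (f^~ j)) ->
  exists m, forall y, agree m x y -> agree n (f x) (f y).
Proof.
move=> fd; elim: n => [|n [m IHm]]; first by exists 0%N => y _ j.
have [[j jn]|none] := pselect (exists j : J, pickle j = n).
  have [k fk] := fd j x; exists (maxn m k) => y xy j'.
  rewrite ltnS leq_eqVlt -jn => /orP[/eqP/(pcan_inj pickleK) ->|].
    by rewrite fk //; exact: agree_leq (leq_maxr _ _) xy.
  by rewrite jn; apply: IHm; exact: agree_leq (leq_maxl _ _) xy.
exists m => y xy j; rewrite ltnS leq_eqVlt => /orP[/eqP jn|/(IHm y xy) //].
by case: none; exists j.
Qed.

Lemma fin_det_continuous (I J : countType)
    (f : {ptws I -> nat} -> {ptws J -> nat}) :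
  (forall j, fin_det (fun x => f x j)) -> continuous f.
Proof.
move=> fd x A /nbhs_agree[n nA]; apply/nbhs_agree.
have [m fm] := fin_det_agree x n fd.
by exists m => y /fm/nA.
Qed.

(** The distance takes values in [R], so the type carrying the metric has to
    mention [R]. *)
Definition baire_metric (R : realType) (I : countType) : Type := I -> nat.

Section BaireMetric.
Context (R : realType) (I : countType).
Implicit Types x y z : I -> nat.

(** The exponent is chosen so that the balls of radius [2^-n] are exactly the
    classes of [agree n] ([baire_dist_lt]). *)
Definition baire_dist x y : R :=
  if pselect (exists n, ~~ `[< agree n x y >]) is left ex
  then 2%:R ^- ex_minn ex else 0.

Lemma baire_dist_ge0 x y : 0 <= baire_dist x y.
Proof.
by rewrite /baire_dist; case: pselect => // ?; rewrite invr_ge0 exprn_ge0.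
Qed.

Lemma baire_dist_lt n x y : (baire_dist x y < 2%:R ^- n) <-> agree n x y.
Proof.
have pow_gt0 k : (0 : R) < 2%:R ^- k by rewrite invr_gt0 exprn_gt0.
rewrite /baire_dist; case: pselect => [ex|none].
  case: ex_minnP => m /asboolPn not_m min_m.
  rewrite ltf_pV2 ?posrE ?exprn_gt0 // ltr_eXn2l ?ltr1n //.
  split=> [lt_nm|nxy].
    apply: contrapT => nxy; have /min_m : ~~ `[< agree n x y >] by apply/asboolPn.
    by rewrite leqNgt lt_nm.
  by rewrite ltnNge; apply/negP => le_mn; apply/not_m/(agree_leq le_mn).
split=> // _; apply: contrapT => nxy; apply: none; exists n; exact/asboolPn.
Qed.

Lemma baire_dist_triangle y x z :
  baire_dist x z <= baire_dist x y + baire_dist y z.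
Proof.
rewrite {1}/baire_dist; case: pselect => [ex|_]; last first.
  by rewrite addr_ge0 ?baire_dist_ge0.
case: ex_minnP => m /asboolPn not_m _; rewrite leNgt; apply/negP => lt_m.
apply: not_m; apply: (@agree_trans _ _ _ y); apply/baire_dist_lt.
  by apply: le_lt_trans lt_m; rewrite lerDl baire_dist_ge0.
by apply: le_lt_trans lt_m; rewrite lerDr baire_dist_ge0.
Qed.

Lemma baire_distC x y : baire_dist x y = baire_dist y x.
Proof.
have agreeC n : `[< agree n x y >] = `[< agree n y x >].
  by apply/asboolP/asboolP; exact: agree_sym.
rewrite /baire_dist; case: pselect => [ex|none]; case: pselect => [ex'|none'] //.
- by congr (2%:R ^- _); apply: eq_ex_minn => n; rewrite agreeC.
- by case: none'; have [n] := ex; exists n; rewrite -agreeC.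
by case: none; have [n] := ex'; exists n; rewrite agreeC.
Qed.

Lemma baire_distxx x : baire_dist x x = 0.
Proof.
rewrite /baire_dist; case: pselect => // ex; exfalso.
by have [n /asboolPn] := ex; apply.
Qed.

Lemma baire_dist_eq0 x y : baire_dist x y = 0 -> x = y.
Proof.
move=> d0; apply: agree_eq => n; apply/baire_dist_lt.
by rewrite d0 invr_gt0 exprn_gt0.
Qed.

HB.instance Definition _ := gen_eqMixin (baire_metric R I).
HB.instance Definition _ := gen_choiceMixin (baire_metric R I).
HB.instance Definition _ := isMetric.Build R (baire_metric R I)
  baire_distxx baire_dist_eq0 baire_distC baire_dist_triangle.

End BaireMetric.

Section Polish.
Context (R : realType).

Lemma half_pow_lt (e : R) : 0 < e -> exists n, 2%:R ^- n < e.
Proof.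
move=> e0; have [n _ /(_ n (leqnn n))] := near_infty_natSinv_expn_lt (PosNum e0).
by rewrite /= div1r; exists n.
Qed.

Section PolishPointwise.
Context (I : countType).
Local Notation X := {ptws I -> nat}.
Local Notation M := (baire_metric R I).

Lemma nbhs_baire_metric (x : M) (A : set M) :
  nbhs x A <-> exists n, forall y : M, agree n x y -> A y.
Proof.
split=> [/nbhs_ballP[e /= e0 eA]|[n nA]].
  have [n ne] := half_pow_lt e0; exists n => y /(baire_dist_lt R) xy.
  by apply: eA; rewrite ballEmdist /=; exact: lt_trans ne.
apply/nbhs_ballP; exists (2%:R ^- n); first by rewrite /= invr_gt0 exprn_gt0.
by move=> y; rewrite ballEmdist /= => /baire_dist_lt/nA.
Qed.

(** A Cauchy filter decides every coordinate, and the point with the decided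
    coordinates is its limit. *)
Lemma baire_metric_complete : complete_space M.
Proof.
move=> F PF /cauchyP Fc.
have /choice[c cP] : forall n, exists x : M, F [set y | agree n x y].
  move=> n; have pow_gt0 : (0 : R) < 2%:R ^- n by rewrite invr_gt0 exprn_gt0.
  have [x Fx] := Fc _ pow_gt0; exists x; apply: filterS Fx => y.
  by rewrite ballEmdist /= => /baire_dist_lt.
exists (fun i => c (pickle i).+1 i) => A /nbhs_baire_metric[n nA].
apply: filterS (cP n) => y cy; apply: nA => i lt_i.
have [z [zi zn]] := filter_ex (filterI (cP (pickle i).+1) (cP n)).
by rewrite zi // -zn // cy.
Qed.

(** The eventually zero functions are dense, the index set being ordered by its
    encoding in [nat]. *)
Lemma baire_separable : separable_space X.
Proof.
exists (range (fun s : seq nat => (fun i => nth 0%N s (pickle i)) : X)).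
  exact: card_le_trans (card_image_le _ _) (countableP _).
move=> U [x Ux] oU.
have /nbhs_agree[n nU] : nbhs x U by exact: open_nbhs_nbhs.
pose s := mkseq (fun k => oapp x 0%N (@unpickle I k)) n.
exists (fun i => nth 0%N s (pickle i)); split; last by exists s.
by apply: nU => i lt_i; rewrite nth_mkseq // pickleK.
Qed.

Lemma polish_ptws : polish R X.
Proof.
split; first exact: baire_separable.
exists M; first exact: baire_metric_complete.
exists id, id; split=> // x A.
  by move=> /nbhs_agree ?; apply/nbhs_baire_metric.
by move=> /nbhs_baire_metric ?; apply/nbhs_agree.
Qed.

End PolishPointwise.
End Polish.

(** * Projections of closed sets are analytic *)

(** Closedness in the product topology, in a form that quantifies over the
    approximations directly. *)
Definition limit_closed (I : countType) (C : set (I -> nat)) :=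
  forall x, (forall n, exists2 c, C c & agree n x c) -> C x.

Lemma fin_det_closed (I : countType) (C : set (I -> nat)) :
  fin_det C -> limit_closed C.
Proof.
move=> Cfd x lim; have [n nC] := Cfd x; have [c Cc /nC <-] := lim n.
exact: Cc.
Qed.

Lemma limit_closedI (I : countType) (C D : set (I -> nat)) :
  limit_closed C -> limit_closed D -> limit_closed (fun x => C x /\ D x).
Proof.
move=> Ccl Dcl x lim; split; [apply: Ccl | apply: Dcl] => n;
  by have [c [Cc Dc] xc] := lim n; exists c.
Qed.

Lemma limit_closed_forall (I : countType) (K : Type) (C : K -> set (I -> nat)) :
  (forall k, limit_closed (C k)) -> limit_closed (fun x => forall k, C k x).
Proof.
by move=> Ccl x lim k; apply: Ccl => n; have [c Cc xc] := lim n; exists c.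
Qed.

Section Retraction.
Context (I : countType) (C : set (I -> nat)) (c0 : I -> nat).
Hypothesis C_c0 : C c0.
Hypothesis C_closed : limit_closed C.

(** The chosen extension has to depend on the first [n] coordinates alone, and
    truncation makes this hold by definition ([extension_eq]). *)
Definition truncate n (x : I -> nat) : I -> nat :=
  fun i => if (pickle i < n)%N then x i else 0%N.

Definition extension n (x : I -> nat) : I -> nat :=
  if pselect (exists2 c, C c & agree n (truncate n x) c) is left ex
  then s2val (cid2 ex) else c0.

Definition extendable n (x : I -> nat) := exists2 c, C c & agree n x c.

(** A point outside the closed set [C] leaves it after finitely many coordinates;
    it is moved to an element of [C] that extends its longest extendable
    initial part. *)
Definition retract (x : I -> nat) : I -> nat :=
  if pselect (exists n, ~~ `[< extendable n x >]) is left ex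
  then extension (ex_minn ex).-1 x else x.

Lemma agree_truncate n x : agree n (truncate n x) x.
Proof. by move=> i lt_i; rewrite /truncate lt_i. Qed.

Lemma extension_eq n x y : agree n x y -> extension n x = extension n y.
Proof.
move=> xy; rewrite /extension; have -> // : truncate n x = truncate n y.
by apply/funext => i; rewrite /truncate; case: ifP => // /xy.
Qed.

Lemma extensionP n x :
  extendable n x -> C (extension n x) /\ agree n x (extension n x).
Proof.
move=> [c Cc xc]; rewrite /extension; case: pselect => [ex|none].
  case: cid2 => d Cd xd /=; split=> //.
  by apply: agree_trans xd; apply: agree_sym; exact: agree_truncate.
by case: none; exists c => //; apply: agree_trans xc; exact: agree_truncate.
Qed.

Lemma extendable_eq n x y : agree n x y -> extendable n x -> extendable n y.
Proof.
by move=> xy [c Cc xc]; exists c => //; exact: agree_trans (agree_sym xy) xc.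
Qed.

Lemma extendable_leq m n x : (m <= n)%N -> extendable n x -> extendable m x.
Proof. by move=> le_mn [c Cc xc]; exists c => //; exact: agree_leq xc. Qed.

Lemma retract_in x : C (retract x).
Proof.
rewrite /retract; case: pselect => [ex|none].
  case: ex_minnP => m /asboolPn not_m min_m; case: m => [|m] in not_m min_m *.
    by case: not_m; exists c0.
  apply: (extensionP _).1; apply: contrapT => /asboolPn /min_m.
  by rewrite /= ltnn.
apply: C_closed => n; apply: contrapT => nn; apply: none; exists n.
exact/asboolPn.
Qed.

Lemma retract_id x : C x -> retract x = x.
Proof.
rewrite /retract => Cx; case: pselect => // ex; exfalso.
by have [n /asboolPn] := ex; apply; exists x.
Qed.

Lemma agree_retract n x : extendable n x -> agree n x (retract x).
Proof.
move=> nx; rewrite /retract; case: pselect => // ex.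
case: ex_minnP => m /asboolPn not_m min_m.
have lt_nm : (n < m)%N.
  by rewrite ltnNge; apply/negP => le_mn; apply: not_m; exact: extendable_leq nx.
case: m => // m in not_m min_m lt_nm *.
apply: (agree_leq (n := m)) => //; apply: (extensionP _).2.
apply: contrapT => nm; have /min_m : ~~ `[< extendable m x >] by apply/asboolPn.
by rewrite ltnn.
Qed.

Lemma retract_fin_det i : fin_det (fun x => retract x i).
Proof.
move=> x; have [Cx|nCx] := pselect (C x).
  (* Near a fixed point, long initial parts of that point are extendable. *)
  exists (pickle i).+1 => y xy.
  have : extendable (pickle i).+1 y by exists x => //; exact: agree_sym.
  move=> /agree_retract /(_ i (ltnSn _)) <-.
  by rewrite (retract_id Cx) (xy i (ltnSn _)).
(* Outside [C], the stage of failure is determined by finitely many values. *)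
have [n nn] : exists n, ~ extendable n x.
  by apply/existsNP => all_n; apply: nCx; exact: C_closed.
exists n => y xy.
have ext_eq m : (m <= n)%N -> `[< extendable m x >] = `[< extendable m y >].
  move=> le_mn; have xym := agree_leq le_mn xy.
  by apply/asboolP/asboolP; apply: extendable_eq => //; exact: agree_sym.
have [nny ex_x ex_y] : [/\ ~ extendable n y, exists n, ~~ `[< extendable n x >] &
    exists n, ~~ `[< extendable n y >]].
  have nny : ~ extendable n y by apply/asboolPn; rewrite -ext_eq //; apply/asboolPn.
  by split=> //; exists n; apply/asboolPn.
rewrite /retract; case: pselect => // ey; case: pselect => // ex.
case: ex_minnP => b not_b min_b; case: ex_minnP => a not_a min_a.
have le_an : (a <= n)%N by apply: min_a; exact/asboolPn.
have le_bn : (b <= n)%N by apply: min_b; exact/asboolPn.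
have -> : b = a.
  by apply/eqP; rewrite eqn_leq min_b -?ext_eq // min_a // ext_eq.
rewrite (@extension_eq _ x y) //.
exact: agree_leq (leq_trans (leq_pred a) le_an) xy.
Qed.

End Retraction.

(** A nonempty closed set is the image of the whole space by a continuous
    retraction, so its projection is a continuous image of a Polish space. *)
Lemma sigma11_projection (R : realType) (I J : countType)
    (C : set (I -> nat)) (f : (I -> nat) -> J -> nat) :
  limit_closed C -> (forall j, fin_det (f^~ j)) ->
  sigma11 R [set m : {ptws J -> nat} | exists2 z, C z & f z = m].
Proof.
move=> C_closed ffd; have [[z0 Cz0]|noz] := pselect (exists z, C z); last first.
  by left; rewrite -subset0 => m [z Cz _]; case: noz; exists z.
right; exists {ptws I -> nat}, (fun x => f (retract C z0 x)); split.
- exact: polish_ptws.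
- apply: (@fin_det_continuous I J (fun x => f (retract C z0 x))) => j x.
  have [n nf] := ffd j (retract C z0 x).
  have [m mr] := fin_det_agree x n (@retract_fin_det I C z0 C_closed).
  by exists m => y /mr /nf.
apply/seteqP; split=> [m [z Cz <-]|_ [x _ <-]].
  by exists z => //; rewrite retract_id.
by exists (retract C z0 x) => //; exact: (@retract_in I C z0 Cz0 C_closed x).
Qed.

(** * Analytic sets as sets of trees with a branch *)

(** Finite sequences are listed from their last entry to their first one, so
    that the parent of a node is its tail. *)
Fixpoint branch_prefix (y : nat -> nat) (n : nat) : seq nat :=
  if n is m.+1 then y m :: branch_prefix y m else [::].

(** The root counts as a node of every tree. *)
Definition has_branch (T : pred (seq nat)) :=
  exists y : nat -> nat, forall n, T (branch_prefix y n.+1).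

Lemma size_branch_prefix y n : size (branch_prefix y n) = n.
Proof. by elim: n => //= n ->. Qed.

(** The entries of [s] index centres of balls, of radius [2^-i] for the entry at
    height [i], that all contain [p]. *)
Fixpoint dist_chain (R : realType) (M : metricType R) (d : nat -> M) (p : M)
    (s : seq nat) : Prop :=
  if s is v :: s' then mdist p (d v) < 2%:R ^- size s' /\ dist_chain d p s'
  else True.

(** Let [B] be the image of [f] and [d] a dense sequence in its domain.  The nodes
    of the tree of [x] are the lists of centres of balls with radii 1, 1/2,
    1/4, ... having a common point [p] whose image [f p] agrees with [x] up to the
    length of the list.  The common points along a branch form a Cauchy
    sequence, and its limit is a preimage of [x] by continuity. *)
Lemma sigma11_branch (R : realType) (B : set baire_space) :
  sigma11 R B -> exists T : (nat -> nat) -> pred (seq nat),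
    (forall s, fin_det (T^~ s)) /\ forall x, B x <-> has_branch (T x).
Proof.
move=> Bs; have [->|/set0P[b0 Bb0]] := eqVneq B set0.
  exists (fun _ _ => false); split=> [s|x]; first exact: fin_det_cst.
  by split=> // -[y /(_ 0%N)].
case: Bs Bb0 => [-> //|].
move=> [P [f [[[D Dcount Ddense] [M Mcomplete [g [h [ghK hgK gc hc]]]]] fc ->]]].
move=> [p0 _ _].
(* [d] runs through the image in [M] of the countable dense set. *)
have [d dP] : exists d : nat -> M, forall q, D q -> exists n, d n = h q.
  have [e e_inj] := pcard_injP Dcount.
  have /choice[d dP] : forall n, exists q, forall q', D q' -> e q' = n -> q' = q.
    move=> n; have [[q Dq eq]|none] := pselect (exists2 q, D q & e q = n).
      by exists q => q' Dq' eq'; apply: e_inj; rewrite ?inE // eq eq'.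
    by exists p0 => q Dq eq; case: none; exists q.
  by exists (h \o d) => q Dq; exists (e q); rewrite /= -(dP _ q Dq erefl).
exists (fun x s =>
  `[< exists p : M, dist_chain d p s /\ agree (size s) (f (g p)) x >]).
split=> [s x|x].
  exists (size s) => x' xx'; apply/asboolP/asboolP => -[p [ps fp]]; exists p.
    by split=> //; apply: agree_trans fp _; exact: agree_sym.
  by split=> //; apply: agree_trans fp _.
split=> [[q _ <-]|[y yT]].
  have /choice[y yP] : forall n, exists v, mdist (h q) (d v) < 2%:R ^- n.
    move=> n; have : nbhs q (h @^-1` ball (h q) (2%:R ^- n)).
      by apply: hc; apply: nbhsx_ballx; rewrite invr_gt0 exprn_gt0.
    rewrite nbhsE => -[U [oU Uq] Ub].
    have [q' [Uq' Dq']] := Ddense U (ex_intro _ q Uq) oU.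
    have [v dv] := dP q' Dq'; exists v; rewrite dv.
    by have := Ub _ Uq'; rewrite /= ballEmdist.
  exists y => n; apply/asboolP; exists (h q); rewrite hgK; split=> //.
  by elim: n.+1 => //= m IHm; rewrite size_branch_prefix.
have /choice[p pP] : forall n, exists p : M,
    dist_chain d p (branch_prefix y n.+1) /\ agree n.+1 (f (g p)) x.
  by move=> n; have /asboolP := yT n; rewrite size_branch_prefix.
have p_near k n : (k <= n)%N -> mdist (p n) (d (y k)) < 2%:R ^- k.
  have [+ _] := pP n; move: (p n) => q; rewrite -ltnS.
  elim: n.+1 => // m IHm /= [qm qs]; rewrite ltnS leq_eqVlt => /orP[/eqP ->|].
    by rewrite size_branch_prefix in qm.
  exact: IHm.
have [l pl] : exists l : M, p @ \oo --> l.
  apply: Mcomplete; apply/cauchyP => e e0; have [k ke] := half_pow_lt e0.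
  exists (d (y k)); exists k => // n /= le_kn; rewrite ballEmdist /= metric_sym.
  exact: lt_trans (p_near _ _ le_kn) ke.
exists (g l) => //; apply: agree_eq => n.
have : nbhs l [set q | agree n (f (g l)) (f (g q))].
  have : nbhs (g l) (f @^-1` [set z | agree n (f (g l)) z]).
    by apply: fc; apply/nbhs_agree; exists n.
  exact: gc.
move=> /pl [m _ /(_ (maxn m n))]; rewrite /= leq_maxl => /(_ isT) fl.
have [_] := pP (maxn m n); move=> /(agree_leq (leqW (leq_maxr m n))).
exact: agree_trans.
Qed.

(** * Enumerating a countable group without repetition *)

(** The least solution is found by testing finitely many candidates. *)
Lemma fin_det_least (I : countType) (Q : nat -> (I -> nat) -> bool)
    (exQ : forall x, exists n, Q n x) :
  (forall n, fin_det (Q n)) -> fin_det (fun x => ex_minn (exQ x)).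
Proof.
move=> Qfd x; have [m Qm] := fin_det_seq (ex_minn (exQ x)).+1 Qfd x.
exists m => y /Qm eq_seq.
have QE n : (n <= ex_minn (exQ x))%N -> Q n y = Q n x.
  by move=> le_n; have := congr1 (nth false ^~ n) eq_seq; rewrite !nth_mkseq.
case: ex_minnP => a Qa min_a; move: QE; case: ex_minnP => b Qb min_b QE.
have le_ab : (a <= b)%N by apply: min_a; rewrite QE.
by apply/eqP; rewrite eqn_leq le_ab min_b // -QE.
Qed.

Section Enumeration.
Context {I : countType} {V : zmodType} (c : (I -> nat) -> nat -> V).
Hypothesis c_fd : forall n, fin_det (c^~ n).
Hypothesis c_inf : forall x, infinite_set (range (c x)).
Hypothesis cD : forall x m n, exists k, c x k = c x m + c x n.

(** The enumeration [c x] may repeat values.  Keeping only first occurrences makes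
    it injective, and whether an index is a first occurrence is decided by
    finitely many values. *)
Definition fresh x n := c x n \notin mkseq (c x) n.

Lemma fresh_fd n : fin_det (fresh^~ n).
Proof.
apply: (@fin_det_map2 _ _ _ _ (fun v s => v \notin s)) => //.
exact: (fin_det_seq (g := fun n x => c x n)).
Qed.

Lemma next_fresh_ex k x : exists n, (k <= n)%N && fresh x n.
Proof.
apply: contrapT => /forallNP none; apply: (c_inf (x := x)).
have fin : finite_set [set` mkseq (c x) k] by exact: finite_seq.
apply: sub_finite_set fin => _ [n _ <-] /=.
elim/ltn_ind: n => n IHn; have [lt_nk|le_kn] := ltnP n k.
  by apply/(nthP 0); exists n; rewrite ?size_mkseq ?nth_mkseq.
have := none n; rewrite le_kn /fresh => /negP; rewrite negbK.
case/(nthP 0) => i; rewrite size_mkseq => lt_in; rewrite nth_mkseq // => <-.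
exact: IHn.
Qed.

Definition next_fresh k x := ex_minn (next_fresh_ex k x).

Lemma next_fresh_fd k : fin_det (next_fresh k).
Proof.
apply: fin_det_least => n; apply: fin_det_map; exact: fresh_fd.
Qed.

Fixpoint fresh_pos x k :=
  next_fresh (if k is k'.+1 then (fresh_pos x k').+1 else 0) x.

Lemma fresh_pos_fd k : fin_det (fresh_pos^~ k).
Proof.
elim: k => [|k IHk] /=; first exact: next_fresh_fd.
apply: (fin_det_bind (g := fun a x => next_fresh a.+1 x)) => // a.
exact: next_fresh_fd.
Qed.

Lemma fresh_posP x k : fresh x (fresh_pos x k).
Proof. by case: k => [|k] /=; rewrite /next_fresh; case: ex_minnP => n /andP[]. Qed.

Lemma fresh_pos_lt x : {homo fresh_pos x : m n / (m < n)%N}.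
Proof.
apply: homo_ltn => [? ? ?|k /=]; first exact: ltn_trans.
by rewrite /next_fresh; case: ex_minnP => n /andP[].
Qed.

Lemma fresh_pos_onto x n : fresh x n -> exists k, fresh_pos x k = n.
Proof.
move=> fresh_n; have ex : exists k, (n <= fresh_pos x k)%N.
  exists n; elim: n {fresh_n} => // n IHn.
  exact: leq_ltn_trans IHn (fresh_pos_lt x (ltnSn n)).
case: (ex_minnP ex) => k le_nk min_k; exists k; apply/eqP; rewrite eqn_leq le_nk andbT.
case: k => [|k] in le_nk min_k *; rewrite /= /next_fresh; case: ex_minnP => j _; apply.
  by rewrite leq0n.
by rewrite fresh_n andbT ltnNge; apply/negP => /min_k; rewrite ltnn.
Qed.

Definition enumerate x k := c x (fresh_pos x k).

Lemma enumerate_fd k : fin_det (enumerate^~ k).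
Proof.
apply: (fin_det_bind (g := fun n x => c x n)) => //; exact: fresh_pos_fd.
Qed.

Lemma enumerate_inj x : injective (enumerate x).
Proof.
suff lt_neq i j : (i < j)%N -> enumerate x i <> enumerate x j.
  move=> i j eq_ij; case: (ltngtP i j) => // /lt_neq; [|move/nesym];
    by rewrite eq_ij.
move=> /(fresh_pos_lt x) lt_ij eq_ij; have /negP := fresh_posP x j; apply.
apply/(nthP 0); exists (fresh_pos x i); rewrite ?size_mkseq // nth_mkseq //.
Qed.

Lemma range_enumerate x : range (enumerate x) = range (c x).
Proof.
apply/seteqP; split=> [_ [k _ <-]|_ [n _ <-]]; first by exists (fresh_pos x k).
have ex : exists i, c x i == c x n by exists n.
case: (ex_minnP ex) => i /eqP ci min_i.
have /fresh_pos_onto[k ki] : fresh x i.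
  apply/negP => /(nthP 0)[j]; rewrite size_mkseq => lt_ji; rewrite nth_mkseq // => cj.
  have /min_i : c x j == c x n by rewrite cj ci.
  by rewrite leqNgt lt_ji.
by exists k => //; rewrite /enumerate ki.
Qed.

Lemma enumerate_add_ex p x :
  exists k, enumerate x k == enumerate x p.1 + enumerate x p.2.
Proof.
have [k ck] := cD x (fresh_pos x p.1) (fresh_pos x p.2).
have : range (c x) (c x k) by exists k.
by rewrite -range_enumerate => -[j _ jk]; exists j; rewrite jk ck.
Qed.

Definition enumerated_op x p := ex_minn (enumerate_add_ex p x).

Lemma enumerated_op_fd p : fin_det (enumerated_op^~ p).
Proof.
apply: fin_det_least => k.
apply: (@fin_det_map2 _ _ _ _ (fun u v : V => u == v)); first exact: enumerate_fd.
by apply: fin_det_map2; exact: enumerate_fd.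
Qed.

Lemma enumerated_opE x a b :
  enumerate x (enumerated_op x (a, b)) = enumerate x a + enumerate x b.
Proof. by rewrite /enumerated_op; case: ex_minnP => k /eqP. Qed.

End Enumeration.

(** * Decomposability and rank *)

(** A decomposition of the group [G], presented as the projection onto one of the
    summands along the other one; [G] is a subset so that the same notion serves
    both abstract groups and subgroups of a vector space. *)
Definition splitting (U : zmodType) (G : set U) (P : U -> U) : Prop :=
  [/\ forall x, G x -> G (P x),
      forall x y, G x -> G y -> P (x - y) = P x - P y,
      forall x, G x -> P (P x) = P x,
      (exists2 x, G x & P x <> 0) &
      (exists2 x, G x & P x <> x)].

Lemma splitting_transport (U W : zmodType) (A : set U) (B : set W)
    (f : U -> W) (g : W -> U) (P : U -> U) :
  (forall x, A x -> B (f x)) -> (forall y, B y -> A (g y)) ->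
  (forall x, A x -> g (f x) = x) -> (forall y, B y -> f (g y) = y) ->
  (forall x y, A x -> A y -> f (x - y) = f x - f y) ->
  (forall x y, B x -> B y -> g (x - y) = g x - g y) ->
  splitting A P -> splitting B (f \o P \o g).
Proof.
move=> fA gB fK gK fB' gB' [PA PB PP [x xA Px] [y yA Py]].
split=> [z /gB/PA/fA //|z t zB tB|z zB||] /=.
- by rewrite gB' // PB ?fB' //; [apply/PA/gB|apply/PA/gB|apply/gB|apply/gB].
- by rewrite fK ?PP //; [apply/gB|apply/PA/gB].
- have g0 : g 0 = 0 by have := gB' _ _ (fA x xA) (fA x xA); rewrite !subrr.
  exists (f x); first exact: fA.
  by rewrite fK // => /(congr1 g); rewrite g0 fK //; exact: PA.
- exists (f y); first exact: fA.
  by rewrite fK // => /(congr1 g); rewrite !fK //; exact: PA.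
Qed.

(** The summands are recovered as the image and the kernel of the projection. *)
Lemma decomposableP (G : zmodType) :
  decomposable G <-> exists P : G -> G, splitting [set: G] P.
Proof.
split=> [[H [K [[H0 HB] [K0 KB] [h Hh h_neq0] [k Kk k_neq0] [HK HKT]]]]|].
  have HKE x y : H x -> K y -> x = y -> x = 0.
    move=> Hx Ky eq_xy; have : (H `&` K) x by split=> //; rewrite eq_xy.
    by rewrite HK.
  have uniq_h x y x' y' : H x -> K y -> H x' -> K y' -> x + y = x' + y' -> x = x'.
    move=> Hx Ky Hx' Ky' eq_xy; apply/eqP; rewrite -subr_eq0; apply/eqP.
    apply: (HKE _ (y' - y)); [exact: HB | exact: KB |].
    by apply/eqP; rewrite subr_eq addrAC eq_sym subr_eq (addrC y') eq_xy.
  have /choice[P PP] : forall x, exists y, H y /\ K (x - y).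
    by move=> x; have [y [z [Hy Kz ->]]] := HKT x; exists y; rewrite addrC addKr.
  have PE x y : H x -> K y -> P (x + y) = x.
    move=> Hx Ky; have [Hp Kp] := PP (x + y).
    by apply: (uniq_h _ (x + y - P (x + y)) _ y) => //; rewrite addrC subrK.
  exists P; split=> // [x y _ _|x _||].
  - have -> : x - y = P x - P y + ((x - P x) - (y - P y)).
      by rewrite addrACA -opprD ![_ + (_ - _)]addrC !subrK.
    by have [[? ?] [? ?]] := (PP x, PP y); rewrite PE //; [exact: HB | exact: KB].
  - by rewrite -[X in P X]addr0 PE //; have [] := PP x.
  - by exists h => //; rewrite -[X in P X]addr0 PE.
  by exists k => //; rewrite -[X in P X]add0r PE // => /esym.
move=> [P [_ PB PP [x _ Px] [y _ Py]]].
have P0 : P 0 = 0 by have := PB 0 0 I I; rewrite !subrr.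
exists [set x | P x = x], [set x | P x = 0]; split.
- by split=> //= u v Pu Pv; rewrite PB ?Pu ?Pv.
- by split=> //= u v Pu Pv; rewrite PB ?Pu ?Pv ?subr0.
- by exists (P x) => //; exact: PP.
- exists (y - P y); first by rewrite /= PB ?PP ?subrr.
  by move=> /eqP; rewrite subr_eq0 => /eqP /esym.
split.
  by apply/seteqP; split=> [z [/= -> //]|_ ->]; split.
move=> z; exists (P z), (z - P z); split; first exact: PP.
  by rewrite /= PB ?PP ?subrr.
by rewrite addrC subrK.
Qed.

(** Independence along a sequence is a countable family of conditions, each of
    which involves finitely many terms; this is what makes infinite rank an
    analytic condition. *)
Definition independent_seq (G : zmodType) (b : nat -> G) :=
  forall c : seq int, \sum_(i < size c) b i *~ c`_i = 0 ->
    forall i, (i < size c)%N -> c`_i = 0.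

Lemma independent_seq_inj (G : zmodType) (b : nat -> G) :
  independent_seq b -> injective b.
Proof.
move=> ind; suff inj_lt i j : (i < j)%N -> b i <> b j.
  move=> i j eq_b; case: (ltngtP i j) => [/inj_lt|/inj_lt/nesym|] //.
move=> lt_ij eq_b; pose c := mkseq (fun n => (n == i)%:R - (n == j)%:R : int) j.+1.
have := ind c; rewrite size_mkseq => /(_ _ i) ci.
suff : c`_i = 0 by rewrite nth_mkseq ?eqxx ?ltn_eqF // ltnS ltnW.
apply: ci; last by rewrite ltnS ltnW.
rewrite (eq_bigr (fun n : 'I__ => (if n == i :> nat then b n else 0) -
  (if n == j :> nat then b n else 0))); last first.
  move=> n _; rewrite nth_mkseq // mulrzBr.
  by congr (_ - _); case: eqP.
rewrite sumrB -!big_mkcond /= (big_pred1 (Ordinal (ltnW lt_ij : (i < j.+1)%N))) //.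
by rewrite (big_pred1 (@ord_max j)) //= eq_b subrr.
Qed.

Lemma independent_range (G : zmodType) (b : nat -> G) :
  independent_seq b -> lin_independent (range b).
Proof.
move=> ind s c s_uniq s_sub sum0 x xs.
have b_inj := independent_seq_inj ind.
have /choice[g gP] : forall y, exists i, y \in s -> b i = y.
  move=> y; have [/s_sub[i _ <-]|_] := boolP (y \in s); first by exists i.
  by exists 0%N.
pose N := (\max_(y <- s) g y).+1.
have gN y : y \in s -> (g y < N)%N.
  by move=> ys; rewrite ltnS; exact: leq_bigmax_seq.
pose d := mkseq (fun i => if b i \in s then c (b i) else 0) N.
have := ind d; rewrite size_mkseq => /(_ _ (g x) (gN x xs)).
rewrite nth_mkseq ?gN // gP // xs; apply.
rewrite -[RHS]sum0 -(big_mkord xpredT (fun i => b i *~ d`_i)) /=.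
(* Both sums run over [s]: the left one through its indices, padded by zeros. *)
have perm_s : perm_eq [seq y <- map b (index_iota 0 N) | y \in s] s.
  apply: uniq_perm => //.
    by rewrite filter_uniq // map_inj_uniq // iota_uniq.
  move=> y; rewrite mem_filter andb_idr // => ys.
  by rewrite -(gP y ys) map_f // mem_index_iota gN.
rewrite -(perm_big _ perm_s) big_filter big_map [RHS]big_mkcond.
apply: eq_big_seq => i.
rewrite mem_index_iota /= => lt_i; rewrite nth_mkseq //.
by case: ifP => //; rewrite mulr0z.
Qed.

(** By Zorn's lemma, applied to the sets whose union with [S] is independent. *)
Lemma basis_extension (G : zmodType) (S : set G) :
  lin_independent S -> exists2 B, group_basis B & S `<=` B.
Proof.
move=> indS; pose Q (X : set G) := lin_independent (X `|` S).
have [F FQ Ftot|A [QA Amax]] := @Zorn_bigcup _ Q.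
  move=> s c us sF; pose F' := [set S] `|` [set X `|` S | X in F].
  have F'tot : total_on F' subset.
    move=> X Y [->|[X' FX' <-]] [->|[Y' FY' <-]]; [by left|by left|by right|].
    by case: (Ftot X' Y') => // XY; [left|right]; exact: setSU.
  (* A finite subset of the union of a chain lies in a member of the chain. *)
  have [X F'X sX] : exists2 X, F' X & [set` s] `<=` X.
    elim: s {us} sF => [|x s IHs] sF; first by exists S; [left|].
    have [y ys|X F'X sX] := IHs; first by apply: sF; rewrite /= inE ys orbT.
    have [Y F'Y Yx] : exists2 Y, F' Y & Y x.
      have /sF[[Y FY Yx]|Sx] : x \in x :: s by rewrite inE eqxx.
        by exists (Y `|` S); [right; exists Y | left].
      by exists S; [left|].
    have [XY|YX] := F'tot X Y F'X F'Y.
      by exists Y => // y /=; rewrite inE => /orP[/eqP ->|/sX/XY].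
    by exists X => // y /=; rewrite inE => /orP[/eqP ->|/sX //]; exact: YX.
  case: F'X sX => [->|[X' /FQ QX' <-]]; first exact: indS.
  exact: QX'.
exists (A `|` S); last exact: subsetUr.
split=> // S' indS' AS'; apply/seteqP; split=> //.
apply: contrapT => nsub; apply: (Amax S'); last first.
  by rewrite /Q setUidl //; apply: subset_trans AS'; exact: subsetUr.
split; first by apply: subset_trans AS'; exact: subsetUl.
by move=> S'A; apply: nsub; apply: subset_trans S'A _; exact: subsetUl.
Qed.

Lemma infinite_rankP (G : zmodType) :
  infinite_rank G <-> exists b : nat -> G, independent_seq b.
Proof.
split=> [[B [indB _] /infiniteP/ppcard_leP[b]]|[b ind]].
  have b_inj : injective b by move=> m n; apply: inj; rewrite inE.
  have bB n : B (b n) by exact: funS.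
  exists b => c sum0 i lt_i.
  pose s := map b (index_iota 0 (size c)).
  have indexE j : (j < size c)%N -> index (b j) s = j.
    move=> lt_j; rewrite index_map // -[j in LHS](nth_iota 0%N 0 (n := size c)) //.
    by rewrite /index_iota subn0 index_uniq ?iota_uniq ?size_iota.
  have := indB s (fun x => c`_(index x s)) _ _ _ (b i); rewrite indexE //; apply.
  - by rewrite map_inj_uniq // iota_uniq.
  - by move=> _ /= /mapP[j _ ->]; exact: bB.
  - rewrite big_map big_mkord -[RHS]sum0; apply: eq_bigr => j _.
    by rewrite indexE.
  - by rewrite map_f // mem_index_iota.
have [B Bbasis bB] := basis_extension (independent_range ind).
exists B => //; apply: sub_infinite_set bB _.
move=> /(finite_preimage (f := b)); have -> : b @^-1` range b = setT.
  by apply/seteqP; split=> // n _; exists n.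
move=> fin; apply: infinite_nat; apply: fin => m n _ _.
exact: independent_seq_inj.

Qed.

(** * The set of decomposable groups is analytic *)

Section Operations.
Context (op : nat -> nat -> nat) (e : nat) (inv : nat -> nat).

Definition op_natmul n x := iter n (op x) e.

Definition op_intmul (z : int) x :=
  match z with Posz n => op_natmul n x | Negz n => inv (op_natmul n.+1 x) end.

Definition op_lincomb (b : nat -> nat) (c : seq int) :=
  foldr (fun i a => op (op_intmul c`_i (b i)) a) e (iota 0 (size c)).

(** Membership in the set with all existential witnesses made explicit: the neutral
    element [e], the inverse function, the projection [P], the independent sequence
    [b], and [u], [w] showing that neither summand is trivial. *)
Definition tf_decomposition (P b : nat -> nat) (u w : nat) : Prop :=
  ((forall x y z, op x (op y z) = op (op x y) z) /\
   (forall x y, op x y = op y x) /\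
   (forall x, op e x = x) /\
   (forall x, op (inv x) x = e)) /\
  (forall x n, (0 < n)%N -> op_natmul n x = e -> x = e) /\
  (forall c : seq int, op_lincomb b c = e ->
     forall i, (i < size c)%N -> c`_i = 0) /\
  (forall x y, P (op x (inv y)) = op (P x) (inv (P y))) /\
  (forall x, P (P x) = P x) /\ P u <> e /\ P w <> w.

End Operations.

(** The structure on [omega_group] uses a chosen neutral element and chosen
    inverses; by uniqueness they are those of any other presentation. *)
Section OmegaOperations.
Context (m : op_space) (mG : abelian_group_op m).
Local Notation G := (omega_group mG).
Context (e : nat) (inv : nat -> nat).
Hypothesis op0 : forall x, m (e, x) = x.
Hypothesis opN : forall x, m (inv x, x) = e.

Lemma omega_addE (x y : G) : x + y = m (x, y). Proof. by []. Qed.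

Lemma omega_zeroE : (0 : G) = e.
Proof. by have : (e : G) + 0 = 0 := op0 (0 : G)%R; rewrite addr0. Qed.

Lemma omega_oppE (x : G) : - x = inv x.
Proof.
apply/eqP; rewrite eq_sym -addr_eq0; apply/eqP.
by rewrite omega_addE opN omega_zeroE.
Qed.

Lemma omega_natmulE n (x : G) : x *+ n = op_natmul (fun x y => m (x, y)) e n x.
Proof.
rewrite /op_natmul -omega_zeroE; elim: n => [|n IHn]; first by rewrite mulr0n.
by rewrite mulrS IHn.
Qed.

Lemma omega_intmulE z (x : G) :
  x *~ z = op_intmul (fun x y => m (x, y)) e inv z x.
Proof.
case: z => n; first by rewrite -pmulrn omega_natmulE.
by rewrite NegzE mulrNz -pmulrn omega_oppE omega_natmulE.
Qed.

Lemma omega_lincombE (b : nat -> G) c :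
  \sum_(i < size c) b i *~ c`_i = op_lincomb (fun x y => m (x, y)) e inv b c.
Proof.
rewrite /op_lincomb -(big_mkord xpredT (fun i => b i *~ c`_i)) /index_iota subn0.
elim: (iota 0 (size c)) => [|i s IHs]; first by rewrite big_nil omega_zeroE.
by rewrite big_cons IHs omega_intmulE omega_addE.
Qed.

End OmegaOperations.

Lemma tf_decompositionP (m : op_space) :
  decomposable_tf_groups_of_infinite_rank m <->
  exists e inv P b u w,
    tf_decomposition (fun x y => m (x, y)) e inv P b u w.
Proof.
split=> [[mG [tf /infinite_rankP[b ind] /decomposableP[P Psplit]]]|].
  have [e [inv [opA opC op0 opN]]] := mG.
  have zE := @omega_zeroE m mG e op0; have oE := @omega_oppE m mG e inv op0 opN.
  have nE := @omega_natmulE m mG e op0; have lE := @omega_lincombE m mG e inv op0 opN.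
  have [_ PB PP [u _ Pu] [w _ Pw]] := Psplit.
  exists e, inv, P, b, u, w; split; first by split.
  split; first by move=> x n n_gt0; rewrite -nE -zE; exact: tf.
  split; first by move=> c; rewrite -lE -zE; exact: ind.
  split.
    by move=> x y; have := PB x y I I; rewrite !oE.
  by split; [move=> x; exact: PP | rewrite -zE].
move=> [e [inv [P [b [u [w [opax [tf [ind [PB [PP [Pu Pw]]]]]]]]]]]].
have [opA [opC [op0 opN]]] := opax.
have mG : abelian_group_op m by exists e, inv; split.
have zE := @omega_zeroE m mG e op0; have oE := @omega_oppE m mG e inv op0 opN.
have nE := @omega_natmulE m mG e op0; have lE := @omega_lincombE m mG e inv op0 opN.
exists mG; split.
- by move=> x n n_gt0; rewrite nE zE; exact: tf.
- by apply/infinite_rankP; exists b => c; rewrite lE zE; exact: ind.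
apply/decomposableP; exists P; split=> //.
- by move=> x y _ _; rewrite !oE; exact: PB.
- by exists u; rewrite ?zE.
by exists w.
Qed.

(** Each clause of [tf_decomposition] is a family of finitely determined
    conditions, hence closed. *)
Lemma sigma11_decomposable (R : realType) :
  sigma11 R decomposable_tf_groups_of_infinite_rank.
Proof.
(* The left summand of the index set stores the operation.  In the right summand
   the first component is a tag: 0 for the neutral element, 1 for inverses, 2 for
   the projection, 3 for the independent sequence, 4 for [u] and [w]. *)
pose I : countType := (nat * nat + nat * nat)%type.
pose opz (z : I -> nat) x y := z (inl (x, y)).
pose aux (t : nat) (z : I -> nat) x := z (inr (t, x)).
pose C z := tf_decomposition (opz z) (aux 0%N z 0%N) (aux 1%N z) (aux 2%N z)
  (aux 3%N z) (aux 4%N z 0%N) (aux 4%N z 1%N).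
have -> : decomposable_tf_groups_of_infinite_rank =
    [set m | exists2 z, C z & (fun p => z (inl p)) = m].
  apply/seteqP; split=> [m /tf_decompositionP[e [inv [P [b [u [w mP]]]]]]|].
    exists (fun i => match i with
      | inl p => m p
      | inr (t, x) => nth 0%N [:: e; inv x; P x; b x; nth 0%N [:: u; w] x] t
      end) => //.
  move=> _ [z Cz <-]; apply/tf_decompositionP.
  by do 6 eexists; exact: Cz.
apply: sigma11_projection => [|p]; last exact: fin_det_eval.
have opfd t u : fin_det t -> fin_det u -> fin_det (fun z => opz z (t z) (u z)).
  move=> tfd ufd; apply: (fin_det_bind (g := fun a z => opz z a (u z))) => // a.
  apply: (fin_det_bind (g := fun b z => opz z a b)) => // b.
  exact: fin_det_eval.
have auxfd k t : fin_det t -> fin_det (fun z => aux k z (t z)).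
  move=> tfd; apply: (fin_det_bind (g := fun a z => aux k z a)) => // a.
  exact: fin_det_eval.
have eqfd (t u : (I -> nat) -> nat) :
    fin_det t -> fin_det u -> fin_det (fun z => t z = u z).
  exact: fin_det_map2.
have impfd (Q S : (I -> nat) -> Prop) :
    fin_det Q -> fin_det S -> fin_det (fun z => Q z -> S z).
  exact: (fin_det_map2 (fun Q S : Prop => Q -> S)).
have notfd (Q : (I -> nat) -> Prop) : fin_det Q -> fin_det (fun z => ~ Q z).
  exact: (fin_det_map (fun Q : Prop => ~ Q)).
have cst a : fin_det (fun _ : I -> nat => a : nat) by exact: fin_det_cst.
have efd : fin_det (fun z => aux 0%N z 0%N) by exact: auxfd.
have natfd n t : fin_det t ->
    fin_det (fun z => op_natmul (opz z) (aux 0%N z 0%N) n (t z)).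
  move=> tfd; elim: n => [|n IHn] //=; exact: opfd.
have intfd k t : fin_det t -> fin_det (fun z =>
    op_intmul (opz z) (aux 0%N z 0%N) (aux 1%N z) k (t z)).
  by move=> tfd; case: k => n; [|apply: auxfd]; exact: natfd.
have lincombfd c : fin_det (fun z =>
    op_lincomb (opz z) (aux 0%N z 0%N) (aux 1%N z) (aux 3%N z) c).
  rewrite /op_lincomb; elim: (iota _ _) => //= i s IHs.
  by apply: opfd => //; apply: intfd; exact: auxfd.
have leaf (t u : (I -> nat) -> nat) :
    fin_det t -> fin_det u -> limit_closed (fun z => t z = u z).
  by move=> tfd ufd; apply: fin_det_closed; exact: eqfd.
have impleaf (t u : (I -> nat) -> nat) (S : Prop) : fin_det t -> fin_det u ->
    limit_closed (fun z => t z = u z -> S).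
  move=> tfd ufd; apply: fin_det_closed; apply: impfd; first exact: eqfd.
  exact: fin_det_cst.
apply: limit_closedI; first do 3?apply: limit_closedI.
- do 3!(apply limit_closed_forall => ?); apply: leaf;
    by do ?[exact: cst | apply: (opfd)].
- do 2!(apply limit_closed_forall => ?); apply: leaf;
    by do ?[exact: cst | apply: (opfd)].
- apply limit_closed_forall => x; apply: leaf;
    by do ?[exact: cst | exact: efd | apply: (opfd)].
- apply limit_closed_forall => x; apply: leaf;
    by do ?[exact: cst | exact: efd | apply: (opfd) | apply: (auxfd)].
apply: limit_closedI.
  do 3!(apply limit_closed_forall => ?); apply: fin_det_closed.
  by apply: impfd; apply: eqfd => //; exact: natfd.
apply: limit_closedI; first by apply limit_closed_forall => c; exact: impleaf.
apply: limit_closedI.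
  do 2!(apply limit_closed_forall => ?); apply: leaf;
    by do ?[exact: cst | apply: (auxfd) | apply: (opfd)].
apply: limit_closedI.
  apply limit_closed_forall => x; apply: leaf; by do ?[exact: cst | apply: (auxfd)].
apply: limit_closedI; apply: fin_det_closed; apply: notfd; apply: eqfd;
  by do ?[exact: cst | apply: (auxfd)].
Qed.

(** * Linear functionals and integrality at a prime *)

Local Notation vect := {poly rat}.

(** The monomials ['X^i] serve as a countable basis of a rational vector space. *)

Section LinearExtension.
Context (U : lmodType rat) (u : nat -> U).

Definition linext (v : vect) : U := \sum_(i < size v) v`_i *: u i.

Lemma linext_widen (v : vect) n :
  (size v <= n)%N -> linext v = \sum_(i < n) v`_i *: u i.
Proof.
move=> le_n; rewrite /linext (big_ord_widen _ (fun i => v`_i *: u i) le_n).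
rewrite big_mkcond; apply: eq_bigr => i _; case: ltnP => // le_i.
by rewrite nth_default ?scale0r.
Qed.

Fact linext_linear : linear linext.
Proof.
move=> a v w; set n := maxn (size v) (size w).
have [le_v le_w] : (size v <= n)%N /\ (size w <= n)%N.
  by rewrite leq_maxl leq_maxr.
have le_vw : (size (a *: v + w)%R <= n)%N.
  rewrite (leq_trans (size_polyD _ _)) // geq_max le_w andbT.
  exact: leq_trans (size_scale_leq _ _) le_v.
rewrite !(linext_widen (n := n)) // scaler_sumr -big_split; apply: eq_bigr => i _.
by rewrite coefD coefZ scalerDl scalerA.
Qed.

HB.instance Definition _ := GRing.isLinear.Build rat vect U _ linext linext_linear.

Lemma linextXn i : linext 'X^i = u i.
Proof.
rewrite /linext size_polyXn big_ord_recr /= coefXn eqxx scale1r big1 ?add0r //.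
by move=> j _; rewrite coefXn ltn_eqF ?scale0r.
Qed.

End LinearExtension.

(** Integral functionals are allowed infinite support: vectors have finite
    support, and the tree condition needs sums over all children of a node. *)
Definition pairing (w : nat -> int) : vect -> rat^o :=
  linext (fun i => (w i)%:~R : rat^o).
HB.instance Definition _ w := GRing.Linear.on (pairing w).

Lemma pairingXn w i : pairing w 'X^i = (w i)%:~R.
Proof. exact: linextXn. Qed.

Definition coordinate (i : nat) : nat -> int := fun j => (j == i)%:R.

Lemma pairing_coordinate i v : pairing (coordinate i) v = v`_i.
Proof.
rewrite /pairing (linext_widen _ (leq_maxl (size v) i.+1)).
have lt_i : (i < maxn (size v) i.+1)%N by rewrite leq_max leqnn orbT.
rewrite (bigD1 (Ordinal lt_i)) //= big1 => [|j ne_ji].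
  by rewrite /coordinate eqxx addr0 /GRing.scale /= mulr1.
have -> : coordinate i j = 0.
  by rewrite /coordinate (_ : (_ == i) = false) //; apply/negbTE.
by rewrite scaler0.
Qed.

Definition nth_prime (n : nat) : nat :=
  iter n (fun p => s2val (prime_above p)) 2%N.

Lemma prime_nth_prime n : prime (nth_prime n).
Proof. by case: n => [|n] //=; case: prime_above. Qed.

Lemma nth_prime_inj : injective nth_prime.
Proof.
have mono : {homo nth_prime : m n / (m < n)%N}.
  by apply: homo_ltn => [? ? ? /ltn_trans|n]; [exact|rewrite /=; case: prime_above].
move=> m n eq_mn; case: (ltngtP m n) => // /mono; by rewrite eq_mn ltnn.
Qed.

(** Membership in the localization of the integers at [p]. *)
Definition pintegral (p : nat) (q : rat) :=
  exists2 M : nat, ~~ (p %| M)%N & exists z : int, q *+ M = z%:~R.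

Section PIntegral.
Context (p : nat) (p_prime : prime p).

Lemma pintegral_int (z : int) : pintegral p z%:~R.
Proof.
exists 1%N; first by rewrite dvdn1; case: eqP p_prime => // ->.
by exists z.
Qed.

Lemma pintegralD q r : pintegral p q -> pintegral p r -> pintegral p (q + r).
Proof.
move=> [M pM [y qM]] [N pN [z rN]]; exists (M * N)%N.
  by rewrite Euclid_dvdM // negb_or pM.
exists (y *+ N + z *+ M); rewrite mulrnDl mulrnA qM mulnC mulrnA rN.
by rewrite intrD !rmorphMn.
Qed.

Lemma pintegralN q : pintegral p q -> pintegral p (- q).
Proof.
by move=> [M pM [z qM]]; exists M => //; exists (- z); rewrite mulNrn qM intrN.
Qed.

Lemma pintegral_div q r N : prime r -> p != r -> pintegral p q ->
  pintegral p (r%:R ^- N * q).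
Proof.
move=> r_prime neq_pr [M pM [z qM]]; exists (M * r ^ N)%N.
  rewrite Euclid_dvdM // negb_or pM Euclid_dvdX // negb_and.
  by rewrite dvdn_prime2 // neq_pr.
exists z; rewrite -qM mulnC mulrnA -(mulr_natl _ (r ^ N)) natrX mulrA.
by rewrite mulfV ?mul1r // expf_neq0 // pnatr_eq0 -lt0n prime_gt0.
Qed.

(** A denominator prime to [p] cannot cancel a power of [p], so every power of [p]
    divides the numerator of [q]. *)
Lemma pintegral_divisible0 q :
  (forall N, exists2 r, pintegral p r & q = r *+ p ^ N) -> q = 0.
Proof.
move=> qdiv; apply/eqP; rewrite -numq_eq0 -absz_eq0; apply/negPn/negP => num_neq0.
(* [p ^ N] exceeds [N], so dividing the nonzero numerator is impossible. *)
pose N := `|numq q|%N; have [r [M pM [z rM]] qE] := qdiv N.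
have : (p ^ N %| M * `|numq q|)%N.
  have /(congr1 absz) : numq q * M%:Z = z * denq q * (p ^ N)%:Z.
    apply: (@intr_inj rat); rewrite !intrM -rM numqE -!pmulrn.
    move: (denq q)%:~R => d.
    rewrite {1}qE -(mulr_natr r M) -(mulr_natr r (p ^ N)).
    by rewrite -!mulrA; congr (_ * _); rewrite [LHS]mulrC -mulrA mulrCA.
  rewrite !abszM /= mulnC => ->; exact: dvdn_mull.
rewrite Gauss_dvdr; last by rewrite coprimeXl // prime_coprime.
move/dvdn_leq; rewrite lt0n => /(_ num_neq0); rewrite leqNgt => /negP; apply.
exact/ltn_expl/prime_gt1.
Qed.

End PIntegral.

(** * The group of a tree *)

(** The basis vectors are [k_ n] for a level [n], [h_ s] for a finite sequence [s],
    and an auxiliary vector [g_]. *)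
Definition basis_index : countType := (nat + option (seq nat))%type.
Definition basis_code (j : basis_index) : nat := pickle j.
Definition basis_vec (j : basis_index) : vect := 'X^(basis_code j).

Local Notation k_ n := (basis_vec (inl n%N)).
Local Notation h_ s := (basis_vec (inr (Some s))).
Local Notation g_ := (basis_vec (inr None)).

Lemma basis_code_inj : injective basis_code.
Proof. exact: pcan_inj (@pickleK basis_index). Qed.

Lemma pairing_basis w j : pairing w (basis_vec j) = (w (basis_code j))%:~R.
Proof. exact: pairingXn. Qed.

(** Labels stand for distinct primes.  [LabH] forces each [h_ s] and [g_] to be an
    eigenvector of every endomorphism, and [LabB] forces the eigenvalues to be
    equal; [LabC n] confines the image of [k_ n] to level [n]; [LabD n] encodes the
    edges of the tree between levels [n] and [n + 1]. *)
Inductive label :=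
  | LabH of option (seq nat) | LabB of seq nat | LabC of nat | LabD of nat.

Definition label_code (l : label) :
    option (seq nat) + seq nat + (nat + nat) :=
  match l with
  | LabH j => inl (inl j) | LabB s => inl (inr s)
  | LabC n => inr (inl n) | LabD n => inr (inr n)
  end.

Definition label_prime (l : label) : nat := nth_prime (pickle (label_code l)).

Lemma prime_label_prime l : prime (label_prime l).
Proof. exact: prime_nth_prime. Qed.

Lemma label_prime_inj : injective label_prime.
Proof.
move=> l l' /nth_prime_inj /(pcan_inj pickleK).
by case: l l' => [?|?|?|?] [?|?|?|?] //= [->].
Qed.

(** The generators are indexed independently of the tree, so that one enumeration
    of the index type serves the groups of all trees. *)
Inductive gen :=
  | GenH of option (seq nat) | GenB of seq nat | GenK of nat | GenC of seq nat
  | GenS of nat | GenL of nat & seq nat.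

Definition gen_code (a : gen) :
    option (seq nat) + seq nat + (nat + seq nat) + (nat + nat * seq nat) :=
  match a with
  | GenH j => inl (inl (inl j)) | GenB s => inl (inl (inr s))
  | GenK n => inl (inr (inl n)) | GenC s => inl (inr (inr s))
  | GenS n => inr (inl n)       | GenL v s => inr (inr (v, s))
  end.

Definition gen_decode c : gen :=
  match c with
  | inl (inl (inl j)) => GenH j | inl (inl (inr s)) => GenB s
  | inl (inr (inl n)) => GenK n | inl (inr (inr s)) => GenC s
  | inr (inl n) => GenS n       | inr (inr (v, s)) => GenL v s
  end.

Lemma gen_codeK : cancel gen_code gen_decode. Proof. by case. Qed.

HB.instance Definition _ := Countable.copy gen (can_type gen_codeK).

Definition gen_label (a : gen) : label :=
  match a with
  | GenH j => LabH j   | GenB s => LabB s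
  | GenK n => LabC n   | GenC s => LabC (size s)
  | GenS n => LabD n   | GenL _ s => LabD (size s)
  end.

(** The edge from the node [s] to its child [v :: s]. *)
Definition link_vec (v : nat) (s : seq nat) : vect :=
  k_ (size s) + k_ (size s).+1 + (h_ s + h_ (v :: s)).

(** An absent edge contributes 0.  The generator [GenS], present in all trees, is a
    link without target: its image under an endomorphism that kills [g_] and the
    [h_ s] has no coordinate at [g_] and so is a combination of links. *)
Definition gen_vec (T : pred (seq nat)) (a : gen) : vect :=
  match a with
  | GenH j => basis_vec (inr j)
  | GenB s => h_ s + g_
  | GenK n => k_ n
  | GenC s => h_ s
  | GenS n => k_ n + k_ n.+1 + g_
  | GenL v s => if T (v :: s) then link_vec v s else 0
  end.

Section TreeGroup.
Context (T : pred (seq nat)).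

Definition frac_gen (c : gen * nat) : vect :=
  (label_prime (gen_label c.1))%:R ^- c.2 *: gen_vec T c.1.

Definition gen_comb (s : seq (int * (gen * nat))) : vect :=
  \sum_(c <- s) frac_gen c.2 *~ c.1.

Definition tree_group : set vect := range gen_comb.

Lemma tree_group0 : tree_group 0.
Proof. by exists [::]; rewrite // /gen_comb big_nil. Qed.

Lemma tree_groupB x y : tree_group x -> tree_group y -> tree_group (x - y).
Proof.
move=> [s _ <-] [t _ <-]; exists (s ++ [seq (- c.1, c.2) | c <- t]) => //.
rewrite /gen_comb big_cat big_map -sumrN; congr (_ + _).
by apply: eq_bigr => c _; rewrite mulrNz.
Qed.

Lemma tree_groupN x : tree_group x -> tree_group (- x).
Proof.
by move=> xG; rewrite -sub0r; apply: tree_groupB => //; exact: tree_group0.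
Qed.

Lemma tree_groupD x y : tree_group x -> tree_group y -> tree_group (x + y).
Proof. by move=> xG /tree_groupN yG; rewrite -(opprK y); apply: tree_groupB. Qed.

Lemma tree_group_muln x n : tree_group x -> tree_group (x *+ n).
Proof.
move=> xG; elim: n => [|n IHn]; first exact: tree_group0.
by rewrite mulrS; apply: tree_groupD.
Qed.

Lemma tree_group_mulz x z : tree_group x -> tree_group (x *~ z).
Proof.
move=> xG; case: z => n; first by rewrite -pmulrn; apply: tree_group_muln.
by rewrite NegzE mulrNz -pmulrn; apply/tree_groupN/tree_group_muln.
Qed.

Lemma tree_group_frac c : tree_group (frac_gen c).
Proof. by exists [:: (1, c)]; rewrite // /gen_comb big_seq1 mulr1z. Qed.

Lemma tree_group_gen a : tree_group (gen_vec T a).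
Proof.
by have := tree_group_frac (a, 0%N); rewrite /frac_gen expr0 invr1 scale1r.
Qed.

Lemma frac_genK a n :
  gen_vec T a = frac_gen (a, n) *+ label_prime (gen_label a) ^ n.
Proof.
rewrite -scaler_nat /frac_gen scalerA natrX mulfV ?scale1r //.
by rewrite expf_neq0 // pnatr_eq0 -lt0n prime_gt0 ?prime_label_prime.
Qed.

Lemma tree_group_ind (Q : vect -> Prop) :
  Q 0 -> (forall x y, Q x -> Q y -> Q (x - y)) -> (forall c, Q (frac_gen c)) ->
  forall x, tree_group x -> Q x.
Proof.
move=> Q0 QB Qfrac x [s _ <-] {x}.
have QN x : Q x -> Q (- x) by move=> Qx; rewrite -sub0r; apply: QB.
have QD x y : Q x -> Q y -> Q (x + y).
  by move=> Qx Qy; rewrite -(opprK y); apply/QB/QN.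
have Qmul x n : Q x -> Q (x *+ n).
  by move=> Qx; elim: n => // n IHn; rewrite mulrS; apply: QD.
rewrite /gen_comb; elim/big_rec: _ => // -[z c] x _ Qx; apply: QD => //=.
case: z => n; first by rewrite -pmulrn; apply: Qmul.
by rewrite NegzE mulrNz -pmulrn; apply/QN/Qmul.
Qed.

Definition divisible_in (l : label) (x : vect) :=
  forall N, exists2 y, tree_group y & x = y *+ label_prime l ^ N.

Lemma gen_divisible a : divisible_in (gen_label a) (gen_vec T a).
Proof.
move=> N; exists (frac_gen (a, N)); first exact: tree_group_frac.
exact: frac_genK.
Qed.

Lemma divisibleD l x y :
  divisible_in l x -> divisible_in l y -> divisible_in l (x + y).
Proof.
move=> xdiv ydiv N; have [x' x'G ->] := xdiv N; have [y' y'G ->] := ydiv N.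
by exists (x' + y'); [exact: tree_groupD | rewrite mulrnDl].
Qed.

Lemma pairing_gen_int w a : exists z : int, pairing w (gen_vec T a) = z%:~R.
Proof.
have D x y : (exists z : int, pairing w x = z%:~R) ->
    (exists z : int, pairing w y = z%:~R) ->
    exists z : int, pairing w (x + y) = z%:~R.
  by move=> [z xz] [t yt]; exists (z + t); rewrite raddfD /= xz yt intrD.
have B j : exists z : int, pairing w (basis_vec j) = z%:~R.
  by rewrite pairing_basis; eexists.
case: a => [j|s|n|s|n|v s] /=; [| |exact: B|exact: B| |].
- exact: B.
- by apply: (D); exact: B.
- by apply: (D); [apply: (D)|]; exact: B.
case: ifP => _; last by exists 0; rewrite raddf0.
by rewrite /link_vec; apply: (D); apply: (D); exact: B.
Qed.

(** On the whole group [w] takes values integral at the prime of [l], because only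
    the generators labelled [l] have denominators divisible by it and [w] vanishes
    on these.  The value at [x] is then divisible by all powers of that prime. *)
Lemma pairing_divisible0 w l x :
  (forall a, gen_label a = l -> pairing w (gen_vec T a) = 0) ->
  divisible_in l x -> pairing w x = 0.
Proof.
move=> w0 xdiv; have p_prime := prime_label_prime l.
apply: (@pintegral_divisible0 (label_prime l)) => // N; have [y yG ->] := xdiv N.
exists (pairing w y); last by rewrite raddfMn.
elim/tree_group_ind: yG => [|a b IHa IHb|[a n]].
- by rewrite raddf0; apply: (pintegral_int p_prime 0).
- by rewrite raddfB; apply: pintegralD => //; apply: pintegralN.
rewrite linearZ /=; have [eq_l|ne_l] := pselect (gen_label a = l).
  by rewrite w0 // scaler0; apply: (pintegral_int p_prime 0).
have [z ->] := pairing_gen_int w a.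
apply: pintegral_div => //; first exact: prime_label_prime.
  by apply/eqP => /label_prime_inj/esym.
exact: pintegral_int.
Qed.

End TreeGroup.

(** * A branch decomposes the group of the tree *)

Section BranchSplitting.
Context (T : pred (seq nat)) (y : nat -> nat).
Hypothesis y_branch : forall n, T (branch_prefix y n.+1).

(** The values of a linear projection on monomials, those that encode no basis
    vector being sent to 0. *)
Definition branch_image (i : nat) : vect :=
  if @unpickle basis_index i is Some (inl n) then k_ n + h_ (branch_prefix y n)
  else 0.

Definition branch_proj : vect -> vect := linext branch_image.
HB.instance Definition _ := GRing.Linear.on branch_proj.

Lemma branch_proj_k n : branch_proj (k_ n) = k_ n + h_ (branch_prefix y n).
Proof. by rewrite /branch_proj linextXn /branch_image pickleK. Qed.

Lemma branch_proj_h j : branch_proj (basis_vec (inr j)) = 0.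
Proof. by rewrite /branch_proj linextXn /branch_image pickleK. Qed.

Lemma branch_proj_idem x : branch_proj (branch_proj x) = branch_proj x.
Proof.
rewrite {2 3}/branch_proj /linext linear_sum; apply: eq_bigr => i _.
rewrite linearZ /=; congr (_ *: _); rewrite /branch_image.
case: unpickle => [[n|j]|]; rewrite ?raddf0 //.
by rewrite raddfD /= branch_proj_k branch_proj_h addr0.
Qed.

(** The vectors [k_n + k_(n+1) + g] and all links of level [n] are sent to the link
    of level [n] on the branch, which belongs to the group. *)
Lemma branch_proj_divisible a :
  divisible_in T (gen_label a) (branch_proj (gen_vec T a)).
Proof.
have linkE n : k_ n + h_ (branch_prefix y n) +
    (k_ n.+1 + h_ (branch_prefix y n.+1)) = link_vec (y n) (branch_prefix y n).
  by rewrite addrACA /link_vec size_branch_prefix.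
have link_div n : divisible_in T (LabD n) (link_vec (y n) (branch_prefix y n)).
  have := gen_divisible T (GenL (y n) (branch_prefix y n)).
  by rewrite /= size_branch_prefix (y_branch n).
have div0 l : divisible_in T l 0.
  by move=> N; exists 0; [exact: tree_group0 | rewrite mul0rn].
case: a => [j|s|n|s|n|v s]; rewrite /= ?raddfD /= ?branch_proj_h ?addr0 //.
- rewrite branch_proj_k; apply: divisibleD; first exact: gen_divisible T (GenK n).
  have := gen_divisible T (GenC (branch_prefix y n)).
  by rewrite /= size_branch_prefix.
- by rewrite !branch_proj_k linkE.
case: ifP => _; last by rewrite raddf0.
by rewrite !raddfD /= !branch_proj_k !branch_proj_h !addr0 linkE.
Qed.

Lemma branch_proj_group x : tree_group T x -> tree_group T (branch_proj x).
Proof.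
move=> xG; elim/tree_group_ind: xG => [|u v uG vG|[a n]].
- by rewrite raddf0; exact: tree_group0.
- by rewrite raddfB; exact: tree_groupB.
rewrite /frac_gen linearZ /=; have [z zG ->] := branch_proj_divisible a n.
rewrite -scaler_nat scalerA natrX mulVf ?scale1r //.
by rewrite expf_neq0 // pnatr_eq0 -lt0n prime_gt0 ?prime_label_prime.
Qed.

Lemma branch_splitting : splitting (tree_group T) branch_proj.
Proof.
split=> [x||x _||]; first exact: branch_proj_group.
- by move=> u v _ _; rewrite raddfB.
- exact: branch_proj_idem.
- exists (k_ 0); first exact: tree_group_gen T (GenK 0).
  rewrite branch_proj_k => /(congr1 (fun v : vect => v`_(basis_code (inl 0%N)))).
  by rewrite coefD !coefXn eqxx (inj_eq basis_code_inj) coef0.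
exists g_; first exact: tree_group_gen T (GenH None).
by rewrite branch_proj_h => /esym/eqP; rewrite (negbTE (monic_neq0 (monicXn _ _))).
Qed.

End BranchSplitting.

(** * A decomposition yields a branch *)

Lemma coef_basis j i : (basis_vec j)`_i = (i == basis_code j)%:R.
Proof. exact: coefXn. Qed.

Lemma basis_code_eq j j' : (basis_code j == basis_code j') = (j == j').
Proof. by rewrite (inj_eq basis_code_inj). Qed.

Lemma basis_indexE :
  ((forall n m, (inl n == inl m :> basis_index) = (n == m)) *
   (forall n j, (inl n == inr j :> basis_index) = false) *
   (forall n j, (inr j == inl n :> basis_index) = false) *
   (forall s t, (inr (Some s) == inr (Some t) :> basis_index) = (s == t)) *
   (forall s, (inr (Some s) == inr None :> basis_index) = false) *
   (forall s, (inr None == inr (Some s) :> basis_index) = false))%type.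
Proof. by []. Qed.

Lemma succ_neqE n : ((n.+1 == n) = false) * ((n == n.+1) = false).
Proof. by rewrite gtn_eqF // ltn_eqF. Qed.

Lemma pairingBl w w' v :
  pairing (fun i => w i - w' i) v = pairing w v - pairing w' v.
Proof.
rewrite /pairing /linext -sumrB; apply: eq_bigr => i _.
by rewrite intrB scalerBr.
Qed.

Section SplittingBranch.
Context (T : pred (seq nat)) (P : vect -> vect).
Local Notation G := (tree_group T).
Hypothesis PG : forall x, G x -> G (P x).
Hypothesis PB : forall x y, G x -> G y -> P (x - y) = P x - P y.

Let P0 : P 0 = 0.
Proof. by have := PB (tree_group0 T) (tree_group0 T); rewrite !subrr. Qed.

Let PN x : G x -> P (- x) = - P x.
Proof. by move=> xG; rewrite -sub0r PB ?P0 ?sub0r //; exact: tree_group0. Qed.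

Let PD x y : G x -> G y -> P (x + y) = P x + P y.
Proof.
by move=> xG yG; rewrite -{1}(opprK y) PB ?PN ?opprK //; exact: tree_groupN.
Qed.

Let PMn x n : G x -> P (x *+ n) = P x *+ n.
Proof.
move=> xG; elim: n => [|n IHn]; first by rewrite !mulr0n P0.
by rewrite !mulrS PD ?IHn //; exact: tree_group_muln.
Qed.

Lemma additive_mulz x z : G x -> P (x *~ z) = P x *~ z.
Proof.
move=> xG; case: z => n; first by rewrite -!pmulrn PMn.
by rewrite NegzE !mulrNz -!pmulrn PN ?PMn //; exact: tree_group_muln.
Qed.

Let genG a : G (gen_vec T a). Proof. exact: tree_group_gen. Qed.
Let hG j : G (basis_vec (inr j)). Proof. exact: genG (GenH j). Qed.
Let kG n : G (k_ n). Proof. exact: genG (GenK n). Qed.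

Lemma gens_kernel : (forall a, P (gen_vec T a) = 0) -> forall x, G x -> P x = 0.
Proof.
move=> gen0 x xG; suff [] : G x /\ P x = 0 by [].
elim/tree_group_ind: xG => [|u v [uG u0] [vG v0]|[a n]].
- by split; [exact: tree_group0 | exact: P0].
- by split; [exact: tree_groupB | rewrite PB // u0 v0 subrr].
have fG := tree_group_frac T (a, n); split=> //.
have /eqP := gen0 a; rewrite (frac_genK T a n) PMn // -scaler_nat scaler_eq0.
rewrite pnatr_eq0 expn_eq0 eqn0Ngt prime_gt0 ?prime_label_prime //= => /eqP.
exact.
Qed.

Lemma image_divisible a : divisible_in T (gen_label a) (P (gen_vec T a)).
Proof.
move=> N; have [y yG ->] := gen_divisible T a N.
by exists (P y); [exact: PG | rewrite PMn].
Qed.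

Lemma pairing_image0 w a :
  (forall b, gen_label b = gen_label a -> pairing w (gen_vec T b) = 0) ->
  pairing w (P (gen_vec T a)) = 0.
Proof. by move=> w0; apply: (pairing_divisible0 w0); exact: image_divisible. Qed.

Lemma coef_image0 i a :
  (forall b, gen_label b = gen_label a -> (gen_vec T b)`_i = 0) ->
  (P (gen_vec T a))`_i = 0.
Proof.
move=> i0; rewrite -pairing_coordinate; apply: pairing_image0 => b /i0.
by rewrite pairing_coordinate.
Qed.

(** [LabH] makes each [h_ s] and [g_] an eigenvector, and the label of [h_ s + g_]
    makes the eigenvalues of [h_ s] and [g_] equal. *)
Lemma image_h_scalar :
  exists a : rat, forall j, P (basis_vec (inr j)) = a *: basis_vec (inr j).
Proof.
pose al j := (P (basis_vec (inr j)))`_(basis_code (inr j)).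
have PhE j : P (basis_vec (inr j)) = al j *: basis_vec (inr j).
  apply/polyP => i; rewrite coefZ coef_basis.
  have [->|ne_ij] := eqVneq i; first by rewrite mulr1.
  rewrite mulr0; apply: (@coef_image0 _ (GenH j)) => -[] //= _ [->].
  by rewrite coef_basis (negbTE ne_ij).
exists (al None) => -[s|] //; rewrite PhE; congr (_ *: _).
pose w i :=
  coordinate (basis_code (inr (Some s))) i - coordinate (basis_code (inr None)) i.
have : pairing w (P (h_ s + g_)) = 0.
  apply: (@pairing_image0 _ (GenB s)) => -[] //= _ [->].
  rewrite pairingBl !pairing_coordinate !coefD !coef_basis !eqxx !basis_code_eq /=.
  by rewrite addr0 add0r subrr.
rewrite PD // !PhE pairingBl !pairing_coordinate !coefD !coefZ !coef_basis !eqxx.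
rewrite !basis_code_eq /= !mulr1 !mulr0 addr0 add0r => /eqP.
by rewrite subr_eq0 => /eqP.
Qed.

(** An idempotent is 0 or 1 on the span of the [h_ s] and [g_]; the case of 1
    reduces to that of 0 by passing to the complementary projection. *)

Section KillsH.
Hypothesis Ph0 : forall j, P (basis_vec (inr j)) = 0.
Hypothesis PP : forall x, G x -> P (P x) = P x.

(** [x] is a rational combination of the [h_ s] and [g_], which need not be an
    integral one; multiplying by a common denominator makes it so, and the group
    is torsion-free. *)
Lemma kernel_h x : G x ->
  (forall i, x`_i != 0 -> exists j, i = basis_code (inr j)) -> P x = 0.
Proof.
move=> xG xsupp; have [q [a a_neq0 xE]] := rat_poly_scale x.
have xaE : x *~ a = \sum_(i < size q) 'X^i *~ q`_i.
  rewrite xE -scaler_int scalerA mulfV ?intr_eq0 // scale1r.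
  rewrite [LHS]poly_def; apply: eq_bigr => i _.
  by rewrite -scaler_int.
have coef_xa i : q`_i != 0 -> x`_i != 0.
  move=> q_neq0; rewrite xE coefZ coef_map mulf_neq0 ?invr_eq0 ?intr_eq0 //=.
have [_ Psum] : G (\sum_(i < size q) 'X^i *~ q`_i) /\
    P (\sum_(i < size q) 'X^i *~ q`_i) = 0.
  apply: (big_ind (fun v => G v /\ P v = 0)) => [|u v [uG u0] [vG v0]|i _].
  - by split; [exact: tree_group0 | exact: P0].
  - by split; [exact: tree_groupD | rewrite PD // u0 v0 addr0].
  have [->|/coef_xa/xsupp[j ->]] := eqVneq q`_i 0.
    by rewrite mulr0z; split; [exact: tree_group0 | exact: P0].
  split; first exact/tree_group_mulz/hG.
  by rewrite (additive_mulz _ (hG j)) Ph0 mul0rz.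
move/eqP: Psum; rewrite -xaE additive_mulz // -scaler_int scaler_eq0.
rewrite intr_eq0 (negbTE a_neq0) => /eqP.
exact.
Qed.

Lemma coef_image_k n i : (P (k_ n))`_i != 0 ->
  i = basis_code (inl n) \/ exists2 s, size s = n & i = basis_code (inr (Some s)).
Proof.
move=> nz; apply: contrapT => none; move/eqP: nz; case.
apply: (@coef_image0 _ (GenK n)) => -[?|?|m|s|?|? ?] //= [eq_n];
  rewrite coef_basis; case: eqP => // eq_i; case: none;
  first by left; rewrite -eq_n.
by right; exists s.
Qed.

Lemma coef_image_k_size n s : size s != n ->
  (P (k_ n))`_(basis_code (inr (Some s))) = 0.
Proof.
move=> ne_sn; apply/eqP/negPn/negP => /coef_image_k[/basis_code_inj //|].
by case=> t sz_t /basis_code_inj[eq_st]; rewrite eq_st sz_t eqxx in ne_sn.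
Qed.

(** With [b] the coefficient of [k_ n] in its image, the difference of [P (k_ n)]
    and [b k_n] involves only vectors killed by [P].  Hence [P (P (k_ n))] is
    [b] times [P (k_ n)], and idempotence gives [b = 1] or [P (k_ n) = 0]. *)
Lemma image_k_idem n : P (k_ n) = 0 \/ (P (k_ n))`_(basis_code (inl n)) = 1.
Proof.
set b := (P (k_ n))`__.
have PkG : G (P (k_ n)) by exact/PG/kG.
(* [b] may not be an integer; the difference is scaled by its denominator. *)
pose x := P (k_ n) *~ denq b - k_ n *~ numq b.
have Px : P x = 0.
  apply: kernel_h => [|i].
    by apply: tree_groupB; apply: tree_group_mulz.
  rewrite coefB -!scaler_int !coefZ coef_basis.
  have [->|ne_i] := eqVneq i.
    by rewrite -/b mulr1 mulrC numqE subrr eqxx.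
  rewrite mulr0 subr0 => nz.
  have /coef_image_k : (P (k_ n))`_i != 0.
    by apply: contraNneq nz => ->; rewrite mulr0.
  by case=> [eq_i|[s _ ->]]; [rewrite eq_i eqxx in ne_i | exists (Some s)].
move: Px; rewrite /x PB ?additive_mulz ?PP //; [|exact: tree_group_mulz..].
rewrite -mulrzBr => /eqP; rewrite -scaler_int scaler_eq0 intr_eq0 subr_eq0.
move=> /orP[/eqP eq_nd|/eqP]; last by left.
by right; rewrite -[LHS]divq_num_den -eq_nd divff // intr_eq0 denq_neq0.
Qed.

(** Functionals vanishing on the generators labelled [LabD n] vanish on the image of
    [k_n + k_(n+1) + g]; the following lemmas are instances. *)
Lemma pairing_image_link0 w n : pairing w (k_ n + k_ n.+1 + g_) = 0 ->
  (forall v s, size s = n -> T (v :: s) -> pairing w (link_vec v s) = 0) ->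
  pairing w (P (k_ n)) + pairing w (P (k_ n.+1)) = 0.
Proof.
move=> wS wL; have : pairing w (P (k_ n + k_ n.+1 + g_)) = 0.
  apply: (@pairing_image0 _ (GenS n)) => -[?|?|?|?|m|v s] //= [eq_n].
    by rewrite eq_n wS.
  by case: ifP => [Tvs|_]; [rewrite wL | rewrite raddf0].
rewrite !PD //; first by rewrite Ph0 addr0 raddfD.
exact: tree_groupD.
Qed.

(** Tested by the functional that subtracts the coordinates at [k_n] and at
    [k_(n+1)]. *)
Lemma coef_image_k_const n : (P (k_ n))`_(basis_code (inl n)) =
  (P (k_ n.+1))`_(basis_code (inl n.+1)).
Proof.
pose w i :=
  coordinate (basis_code (inl n)) i - coordinate (basis_code (inl n.+1)) i.
have := @pairing_image_link0 w n.
rewrite !pairingBl !pairing_coordinate.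
have off m m' : m != m' -> (P (k_ m))`_(basis_code (inl m')) = 0.
  move=> ne_m; apply/eqP/negPn/negP => /coef_image_k[/basis_code_inj[eq_m]|].
    by rewrite eq_m eqxx in ne_m.
  by case=> s _ /basis_code_inj.
rewrite (off n n.+1) ?ltn_eqF // (off n.+1 n) ?gtn_eqF // subr0 sub0r => link0.
apply/eqP; rewrite -subr_eq0 link0 //.
  rewrite !coefD !coef_basis !basis_code_eq.
  by rewrite !basis_indexE !eqxx !succ_neqE /= !(addr0, add0r) subrr.
move=> v s sz _; rewrite pairingBl !pairing_coordinate /link_vec !coefD !coef_basis.
rewrite !basis_code_eq !basis_indexE sz !eqxx !succ_neqE /=.
by rewrite !(addr0, add0r) subrr.
Qed.

(** The coordinate at a sequence outside the tree vanishes on all links. *)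
Lemma coef_link_absent n t : size t = n.+1 -> ~~ T t ->
  (P (k_ n.+1))`_(basis_code (inr (Some t))) = 0.
Proof.
move=> sz_t nTt.
have := @pairing_image_link0 (coordinate (basis_code (inr (Some t)))) n.
rewrite !pairing_coordinate (@coef_image_k_size n t) ?sz_t ?succ_neqE // add0r; apply.
  by rewrite !coefD !coef_basis !basis_code_eq !basis_indexE !addr0.
move=> v s sz_s Tvs; rewrite pairing_coordinate !coefD !coef_basis !basis_code_eq.
rewrite !basis_indexE !add0r.
have -> : (t == s) = false by apply/eqP => ts; rewrite ts sz_s in sz_t; lia.
have -> : (t == v :: s) = false by apply/eqP => tvs; rewrite tvs Tvs in nTt.
by rewrite addr0.
Qed.

(** The root is the only node of level 0, so that the coordinate at [k_0] minus
    those at [g] and at the root vanishes on [k_0 + k_1 + g] and on all links of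
    level 0. *)
Lemma coef_link_root :
  (P (k_ 0))`_(basis_code (inl 0%N)) = (P (k_ 0))`_(basis_code (inr (Some [::]))).
Proof.
pose w i := coordinate (basis_code (inl 0%N)) i - coordinate (basis_code (inr None)) i
  - coordinate (basis_code (inr (Some [::]))) i.
have := @pairing_image_link0 w 0%N.
rewrite !pairingBl !pairing_coordinate.
have k1 : (P (k_ 1))`_(basis_code (inl 0%N)) = 0.
  by apply/eqP/negPn/negP => /coef_image_k[|[s _]] /basis_code_inj.
have gg n : (P (k_ n))`_(basis_code (inr None)) = 0.
  by apply/eqP/negPn/negP => /coef_image_k[|[s _]] /basis_code_inj.
rewrite k1 !gg (@coef_image_k_size 1%N) // !subr0 ?addr0 => link0.
apply/eqP; rewrite -subr_eq0 link0 //.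
  rewrite !coefD !coef_basis !basis_code_eq.
  by rewrite !basis_indexE !eqxx /= !(addr0, add0r) ?subr0 subrr.
move=> v s /size0nil -> _; rewrite !pairingBl !pairing_coordinate !coefD !coef_basis.
by rewrite !basis_code_eq !basis_indexE !eqxx /= !(addr0, add0r) ?subr0 subrr.
Qed.

(** The coordinate at [s] minus the sum of the coordinates at its children vanishes
    on all links of that level, whence the coordinate of [P k_n] at [s] is the
    sum of those of [P k_(n+1)] at the children of [s]. *)
Lemma coef_link_child n s : size s = n ->
  (P (k_ n))`_(basis_code (inr (Some s))) != 0 ->
  exists v, (P (k_ n.+1))`_(basis_code (inr (Some (v :: s)))) != 0.
Proof.
move=> sz_s nz; apply: contrapT => /forallNP none.
have child0 v : (P (k_ n.+1))`_(basis_code (inr (Some (v :: s)))) = 0.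
  by apply/eqP/negPn/negP/none.
pose child i : int := `[< exists v, i = basis_code (inr (Some (v :: s))) >]%:R.
pose w i := coordinate (basis_code (inr (Some s))) i - child i.
have pairing_child0 (x : vect) :
    (forall v, x`_(basis_code (inr (Some (v :: s)))) = 0) -> pairing child x = 0.
  move=> x0; rewrite /pairing /linext big1 // => i _; rewrite /child.
  by case: asboolP => [[v ->]|_]; rewrite ?x0 ?scale0r ?scaler0.
have child_off j : (forall v, j <> inr (Some (v :: s))) -> child (basis_code j) = 0.
  by move=> ne_j; rewrite /child; case: asboolP => // -[v /basis_code_inj] /ne_j.
have := @pairing_image_link0 w n.
rewrite !pairingBl !pairing_coordinate.
have -> : pairing child (P (k_ n.+1)) = 0 by exact: pairing_child0.
have -> : pairing child (P (k_ n)) = 0.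
  apply: pairing_child0 => v; apply: coef_image_k_size.
  by rewrite /= sz_s succ_neqE.
rewrite (@coef_image_k_size n.+1) ?sz_s ?succ_neqE // !subr0 ?addr0 => link0.
case/eqP: nz; apply: link0.
  rewrite !coefD !coef_basis !basis_code_eq.
  by rewrite !basis_indexE !raddfD /= !pairing_basis !child_off // !addr0 ?subr0.
move=> v t sz_t _; rewrite !pairingBl !pairing_coordinate !coefD !coef_basis.
rewrite !basis_code_eq !basis_indexE !raddfD /= !pairing_basis.
rewrite !(child_off (inl _)) // child_off ?add0r; last first.
  by move=> u [tE]; move: sz_t; rewrite tE /= sz_s; lia.
have -> : (s == v :: t) = false.
  by apply/eqP => sE; move: sz_s; rewrite sE /= sz_t; lia.
rewrite addr0; have [<-|/eqP ne_st] := eqVneq s t.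
  by rewrite /child asboolT ?subrr //; exists v.
by rewrite child_off ?subr0 // => u [_ /esym].
Qed.

(** The coordinate of [P k_n] at [k_n] is the same for all [n].  It is not 0, as [P]
    would be 0 on all generators.  So it is 1, the root is in the support of
    [P k_0], and each node in the support of [P k_n] has a child in that of
    [P k_(n+1)]. *)
Lemma kills_h_branch : (exists2 x, G x & P x <> 0) -> has_branch T.
Proof.
move=> [x xG Px_neq0].
have b_const n : (P (k_ n))`_(basis_code (inl n)) =
    (P (k_ 0))`_(basis_code (inl 0%N)).
  by elim: n => // n <-; rewrite -coef_image_k_const.
have b1 : (P (k_ 0))`_(basis_code (inl 0%N)) = 1.
  apply: contrapT => b_neq1; case: Px_neq0.
  have Pk0 n : P (k_ n) = 0.
    by case: (image_k_idem n) => // bn; rewrite -(b_const n) bn in b_neq1.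
  have Plink0 v s : P (link_vec v s) = 0.
    rewrite /link_vec !PD ?Pk0 ?Ph0 ?addr0 //; exact: tree_groupD.
  have Pgen0 a : P (gen_vec T a) = 0.
    case: a => [j|s|n|s|n|v s] /=; rewrite ?PD ?Ph0 ?Pk0 ?addr0 //.
      exact: tree_groupD.
    by case: ifP => _; [exact: Plink0 | exact: P0].
  exact: gens_kernel.
have /choice[f fP] : forall s : seq nat, exists v,
    (P (k_ (size s)))`_(basis_code (inr (Some s))) != 0 ->
    T (v :: s) /\ (P (k_ (size s).+1))`_(basis_code (inr (Some (v :: s)))) != 0.
  move=> s; have [/(coef_link_child erefl)[v nz_v]|z_s] := boolP (_ != 0);
    last by exists 0%N.
  exists v => _; split=> //; apply: contraNT nz_v => nT.
  by rewrite coef_link_absent.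
pose sigma n := iter n (fun s => f s :: s) [::].
have sz_sigma n : size (sigma n) = n by elim: n => //= n ->.
have sigmaP n : (P (k_ n))`_(basis_code (inr (Some (sigma n)))) != 0.
  elim: n => [|n IHn]; first by rewrite -coef_link_root b1.
  by have [|_] := fP (sigma n); rewrite sz_sigma.
exists (f \o sigma) => n.
have -> m : branch_prefix (f \o sigma) m = sigma m by elim: m => //= m ->.
by have [|] := fP (sigma n); rewrite ?sz_sigma.
Qed.

End KillsH.

End SplittingBranch.

Lemma splitting_branch T P : splitting (tree_group T) P -> has_branch T.
Proof.
move=> [PG PB PP Pneq0 Pneq1].
have [a Ph] := image_h_scalar PG PB.
have hG j : tree_group T (basis_vec (inr j)) by exact: tree_group_gen (GenH j).
have h_neq0 j : basis_vec j != 0 by rewrite monic_neq0 ?monicXn.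
have [a0|a_neq0] := eqVneq a 0.
  apply: (kills_h_branch PG PB) => // j; by rewrite Ph a0 scale0r.
(* [P] is only additive, so idempotence on [a g] is read off multiples by the
   numerator and the denominator of [a]. *)
have a1 : a = 1.
  have agG : tree_group T (a *: g_) by rewrite -Ph; exact: PG.
  have num_den : a *: g_ *~ denq a = g_ *~ numq a.
    by rewrite -!scaler_int scalerA mulrC numqE.
  have := congr1 P num_den; rewrite !(additive_mulz PB) //.
  have -> : P (a *: g_) = a *: g_ by rewrite -Ph PP.
  rewrite Ph => /eqP; rewrite -subr_eq0 -mulrzBr -scaler_int !scaler_eq0 intr_eq0.
  rewrite (negbTE a_neq0) (negbTE (h_neq0 _)) !orbF subr_eq0 => /eqP eq_dn.
  by rewrite -[LHS]divq_num_den -eq_dn divff // intr_eq0 denq_neq0.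
apply: (kills_h_branch (P := fun x => x - P x)) => [x xG|x y xG yG|j|x xG|].
- by apply: tree_groupB => //; exact: PG.
- by rewrite PB // !opprD !opprK addrACA.
- by rewrite Ph a1 scale1r subrr.
- by rewrite PB ?PP ?subrr ?subr0 //; exact: PG.
have [x xG Px] := Pneq1; exists x => // /eqP; rewrite subr_eq0 => /eqP /esym.
exact: Px.
Qed.

(** * Transport to the natural numbers *)

(** An operation on [nat] is understood through an injection into a group that it
    turns into addition; decompositions are carried back and forth along it. *)

Section EmbeddedOperation.
Context (V : zmodType) (A : set V) (m : op_space) (eps : nat -> V).
Hypothesis A0 : A 0.
Hypothesis AN : forall x, A x -> A (- x).
Hypothesis eps_inj : injective eps.
Hypothesis range_eps : range eps = A.
Hypothesis eps_op : forall x y, eps (m (x, y)) = eps x + eps y.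

Lemma embedded_section : exists g : V -> nat, forall v, A v -> eps (g v) = v.
Proof.
have /choice[g gP] : forall v, exists n, A v -> eps n = v.
  move=> v; have [|nAv] := pselect (A v); last by exists 0%N.
  by rewrite -range_eps => -[n _ <-]; exists n.
by exists g.
Qed.

Lemma embedded_abelian : abelian_group_op m.
Proof.
have [g gP] := embedded_section.
have A_eps x : A (eps x) by rewrite -range_eps; exists x.
exists (g 0), (fun x => g (- eps x)); split=> [x y z|x y|x|x]; apply: eps_inj;
  rewrite !eps_op.
- by rewrite addrA.
- by rewrite addrC.
- by rewrite gP // add0r.
by rewrite !gP ?addNr //; exact: AN.
Qed.

Lemma embedded_sub (mG : abelian_group_op m) (x y : omega_group mG) :
  eps (x - y)%R = eps x - eps y.
Proof.
have epsD (a b : omega_group mG) : eps (a + b)%R = eps a + eps b := eps_op a b.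
by apply/eqP; rewrite eq_sym subr_eq -epsD subrK.
Qed.

Lemma embedded_splitting (mG : abelian_group_op m) :
  (exists P, splitting [set: omega_group mG] P) <-> (exists P, splitting A P).
Proof.
have [g gP] := embedded_section.
have A_eps x : A (eps x) by rewrite -range_eps; exists x.
have epsK x : g (eps x) = x by apply: eps_inj; rewrite gP.
have g_sub v w : A v -> A w ->
    g (v - w) = (g v : omega_group mG) - (g w : omega_group mG).
  move=> Av Aw; apply: eps_inj; rewrite embedded_sub !gP //.
  by rewrite -(gP v Av) -(gP w Aw) -(@embedded_sub mG).
split=> -[P splitP].
  exists (eps \o P \o g); apply: splitting_transport splitP => //.
  by move=> x y _ _; exact: embedded_sub.
exists (g \o P \o eps); apply: splitting_transport splitP => //.
by move=> x y _ _; exact: embedded_sub.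
Qed.

End EmbeddedOperation.

(** The vectors [k_n] witness that the rank is infinite. *)
Lemma tree_group_k_independent (c : seq int) :
  \sum_(i < size c) k_ (nat_of_ord i) *~ c`_i = 0 ->
  forall i, (i < size c)%N -> c`_i = 0.
Proof.
move=> sum0 i lt_i; have := congr1 (fun v : vect => v`_(basis_code (inl i))) sum0.
rewrite coef0 coef_sum (bigD1 (Ordinal lt_i)) //= big1 => [|j ne_ji].
  rewrite addr0 -scaler_int coefZ coef_basis eqxx mulr1 => /eqP.
  by rewrite intr_eq0 => /eqP.
rewrite -scaler_int coefZ coef_basis basis_code_eq basis_indexE.
by rewrite (_ : (i == j) = false) ?mulr0 // eq_sym; exact: negbTE ne_ji.
Qed.

Lemma tree_group_operation (T : pred (seq nat)) (m : op_space) (eps : nat -> vect) :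
  injective eps -> range eps = tree_group T ->
  (forall x y, eps (m (x, y)) = eps x + eps y) ->
  has_branch T <-> decomposable_tf_groups_of_infinite_rank m.
Proof.
move=> eps_inj range_eps eps_op.
have mA := embedded_abelian (tree_group0 T) (@tree_groupN T) eps_inj
  range_eps eps_op.
have epsB (mG : abelian_group_op m) := @embedded_sub _ _ _ eps_op mG.
split=> [[y yT]|[mG [_ _ /decomposableP dec]]]; last first.
  have [P] := (embedded_splitting eps_inj range_eps eps_op mG).1 dec.
  exact: splitting_branch.
exists mA; have eps0 : eps (0 : omega_group mA)%R = 0.
  by rewrite -(subrr (0 : omega_group mA)) epsB subrr.
have epsD (x z : omega_group mA) : eps (x + z)%R = eps x + eps z := eps_op x z.
have epsMn (x : omega_group mA) n : eps (x *+ n)%R = eps x *+ n.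
  by elim: n => [|n IHn]; rewrite ?mulr0n ?eps0 // !mulrS epsD IHn.
have epsMz (x : omega_group mA) z : eps (x *~ z)%R = eps x *~ z.
  case: z => n; first by rewrite -!pmulrn epsMn.
  by rewrite NegzE !mulrNz -!pmulrn -sub0r epsB eps0 sub0r epsMn.
split.
- move=> x n n_gt0 /(congr1 eps); rewrite epsMn eps0 -scaler_nat => /eqP.
  rewrite scaler_eq0 pnatr_eq0 gtn_eqF //= -eps0 => /eqP; exact: eps_inj.
- apply/infinite_rankP.
  have [g gP] := embedded_section range_eps.
  exists (fun n => g (k_ n)) => c sum0; apply: tree_group_k_independent.
  rewrite -[RHS]eps0 -sum0.
  rewrite (big_morph eps epsD eps0); apply: eq_bigr => i _.
  by rewrite epsMz gP //; exact: tree_group_gen (GenK i).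
apply/decomposableP/(embedded_splitting eps_inj range_eps eps_op mA).
by exists (branch_proj y); exact: branch_splitting.
Qed.

Definition tree_group_seq (T : pred (seq nat)) (n : nat) : vect :=
  gen_comb T (odflt [::] (unpickle n)).

Lemma range_tree_group_seq T : range (tree_group_seq T) = tree_group T.
Proof.
apply/seteqP; split=> [_ [n _ <-]|_ [s _ <-]]; first by eexists.
by exists (pickle s) => //; rewrite /tree_group_seq pickleK.
Qed.

Lemma tree_group_infinite T : infinite_set (tree_group T).
Proof.
have sub : range (fun n => k_ n : vect) `<=` tree_group T.
  by move=> _ [n _ <-]; exact: tree_group_gen (GenK n).
apply: sub_infinite_set sub _ => /(finite_preimage (f := fun n => k_ n : vect)).
rewrite (_ : _ @^-1` _ = setT); last by apply/seteqP; split=> // n _; exists n.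
move=> fin; apply: infinite_nat; apply: fin => m n _ _ eq_k.
have := congr1 (fun v : vect => v`_(basis_code (inl m))) eq_k.
rewrite !coef_basis eqxx basis_code_eq basis_indexE.
by case: eqP => // _ /eqP; rewrite oner_eq0.
Qed.

(** * The reduction *)

Section Reduction.
Context (T : (nat -> nat) -> pred (seq nat)).
Hypothesis T_fd : forall s, fin_det (T^~ s).

Let gens x := tree_group_seq (T x).

(** Only the generators of links depend on the tree, and each of them on a single
    node; a given combination of generators involves finitely many. *)
Lemma tree_group_seq_fd n : fin_det (gens^~ n).
Proof.
rewrite /gens /tree_group_seq /gen_comb; move: (odflt _ _) => s.
elim: s => [|[z [a N]] s IHs].
  rewrite (_ : (fun x => _) = fun=> 0); first exact: fin_det_cst.
  by apply/funext => x; rewrite big_nil.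
rewrite (_ : (fun x => _) = fun x => frac_gen (T x) (a, N) *~ z +
  \sum_(c <- s) frac_gen (T x) c.2 *~ c.1); last first.
  by apply/funext => x; rewrite big_cons.
apply: fin_det_map2 => //.
apply: (@fin_det_map _ _ _ (fun v : vect => (_ *: v) *~ z)).
case: a => [j|t|k|t|k|v t] /=; do ?exact: fin_det_cst.
exact: (fin_det_map (fun b : bool => if b then link_vec v t else 0)).
Qed.

Lemma tree_reduction : exists2 F : baire_space -> op_space,
  continuous F &
  forall x, has_branch (T x) <-> decomposable_tf_groups_of_infinite_rank (F x).
Proof.
have range_inf x : infinite_set (range (gens x)).
  by rewrite range_tree_group_seq; exact: tree_group_infinite.
have gensD x m n : exists k, gens x k = gens x m + gens x n.
  have in_group i : tree_group (T x) (gens x i).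
    by rewrite -range_tree_group_seq; exists i.
  have := tree_groupD (in_group m) (in_group n).
  by rewrite -range_tree_group_seq => -[k _ kE]; exists k.
exists (enumerated_op range_inf gensD).
  apply: fin_det_continuous => p; apply: enumerated_op_fd.
  exact: tree_group_seq_fd.
move=> x; apply: (@tree_group_operation _ _ (enumerate range_inf x)).
- exact: enumerate_inj.
- by rewrite range_enumerate range_tree_group_seq.
- by move=> a b; exact: enumerated_opE.
Qed.

End Reduction.

Theorem theorem6p1 (R : realType) :
  sigma11_complete R decomposable_tf_groups_of_infinite_rank.
Proof.
split; first exact: polish_ptws.
  exact: sigma11_decomposable.
move=> B /sigma11_branch[T [T_fd BT]].
have [F Fcont FT] := tree_reduction T_fd.
by exists F => // x; rewrite BT FT.
Qed.
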